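(* Let $r\ge s$ be positive integers. The continuous, piecewise-linear map $\psi\circ\zeta\circ\psi^{-1}\colon\mathbb R^{T_{r,s}}\to\mathbb R^{R_{r,s}}$ (defined in the context) defines a bijection between plane partitions of $T_{r,s}$ and $R_{r,s}$ of height $\ell$ for all $\ell\in\mathbb Z_{\ge0}$.
   Context: $[n]=\{1,\dots,n\}$, and $\lessdot$ denotes cover relations. A plane partition of a finite poset $P$ is a labeling $x\in\mathbb Z_{\ge0}^P$ with $x_p\le x_q$ whenever $p\le q$; it has height $\ell$ if its maximum label is $\ell$. Posets (all with the componentwise order): $R_{r,s}=[r]\times[s]$; the right trapezoid $RT_{r,s}=\{(i,j)\in[r+s-1]\times[s] : i-j<r\}$; the trapezoid $T_{r,s}=\{(i,j)\in RT_{r,s}: i+j>s\}$. For $1\le k\le s$ the intermediate poset $I_k$ is the induced subposet of $RT_{r,s}$ on $T_{r,k}\cup[(k,k+1),(r+k-1,s)]$ (the second set is an interval of $RT_{r,s}$, empty when $k=s$). One has $I_1=R_{r,s}$ and $I_s=T_{r,s}$. For a finite poset $P$, the piecewise-linear map $\psi\colon\mathbb R^P\to\mathbb R^P$ is $\psi(x)_p=\max\sum_{i=1}^n x_{q_i}$, the maximum over all saturated chains $q_1\lessdot\cdots\lessdot q_n=p$ of $P$ with $q_1$ minimal in $P$. It is a bijection with inverse $\psi^{-1}(y)_p=y_p-\max_{q\lessdot p}y_q$ for $p$ not minimal and $\psi^{-1}(y)_p=y_p$ for $p$ minimal. In the composition, the $\psi^{-1}$ on the right is the one for $P=T_{r,s}$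 and the $\psi$ on the left is the one for $P=R_{r,s}$. The piecewise-linear map $\zeta=\zeta_1\circ\zeta_2\circ\cdots\circ\zeta_{s-1}\colon\mathbb R^{T_{r,s}}\to\mathbb R^{R_{r,s}}$ is composed of maps $\zeta_k\colon\mathbb R^{I_{k+1}}\to\mathbb R^{I_k}$ ($1\le k\le s-1$) defined as follows. Let $M_k$ be the interval $[(k,1),(r+k,k+1)]$ of $RT_{r,s}$. For $x\in\mathbb R^{I_{k+1}}$, let $\bar x\in\mathbb R^{M_k}$ be obtained by restricting $x$ to $M_k\setminus\{(k,1)\}\subseteq I_{k+1}$ and setting $\bar x_{k,1}=0$ (any real value gives the same map), and let $y=\psi(\bar x)\in\mathbb R^{M_k}$ (with $\psi$ taken for the poset $M_k$). Then $$\zeta_k(x)_{ij}=\begin{cases}\min\{y_q: q\in M_k,\ q\gtrdot(i,j)\}-y_{ij}&\text{if }(i,j)\in I_k\cap M_k=M_k\setminus\{(r+k,k+1)\},\\ x_{i+1,j}&\text{if }(i,j)\in I_k\setminus M_k\text{ and }j>k+1,\\ x_{i,j+1}&\text{if }(i,j)\in I_k\setminus M_k\text{ and }i<k.\end{cases}$$ *)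

(* Defs.v *)
From HB Require Import structures.
From mathcomp Require Import all_boot all_order all_algebra.
From mathcomp Require Import all_classical all_reals all_analysis.

Set Implicit Arguments.
Unset Strict Implicit.
Unset Printing Implicit Defensive.

Import Order.TTheory GRing.Theory Num.Theory.

Local Open Scope classical_set_scope.
Local Open Scope ring_scope.

Section FinitePosets.
Context {d : Order.disp_t} {P : finPOrderType d}.
Implicit Types p q : P.

Definition minimal p : bool := [forall q, ~~ (q < p)%O].

Definition covers p q : bool := (p < q)%O && [forall z, ~~ (p < z < q)%O].

(* c = [:: q_1; ...; q_n] with q_1 minimal, q_1 <. ... <. q_n and q_n = p *)
Definition saturated_chain_to p (c : seq P) : bool :=
  if c is q :: c' then [&& minimal q, path covers q c' & last q c' == p]
  else false.

End FinitePosets.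

Section MaxMin.
Context {R : realType}.

(* maximum and minimum of a nonempty list (junk value 0 on the empty list) *)
Definition maxs (v : seq R) : R := \big[Num.max/head 0 v]_(a <- v) a.
Definition mins (v : seq R) : R := \big[Num.min/head 0 v]_(a <- v) a.

End MaxMin.

Section Psi.
Context {R : realType} {d : Order.disp_t} {P : finPOrderType d}.

(* A saturated chain has no repeated element, hence length at most #|P|, so
   nothing is lost by ranging over the finite type #|P|.-bseq P. *)
Definition psi (x : P -> R) : P -> R := fun p =>
  maxs [seq \sum_(q <- (c : seq P)) x q
       | c : #|P|.-bseq P <- enum [pred c : #|P|.-bseq P | saturated_chain_to p c]].

Definition psi_inv (y : P -> R) : P -> R := fun p =>
  if minimal p then y p
  else y p - maxs [seq y q | q <- enum [pred q | covers q p]].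

(* The plane partitions of P of height l, as points of R^P.  *)
Definition plane_partitions (l : nat) : set (P -> R) :=
  [set x | [/\ forall p, x p \is a Num.nat,
               forall p q, (p <= q)%O -> x p <= x q,
               forall p, x p <= l%:R
             & exists p, x p = l%:R]].

End Psi.

Section PiecewiseLinear.
Context {R : realType} {P Q : finType}.

Definition polyhedron (K : set (P -> R)) : Prop :=
  exists m (a : 'I_m -> P -> R) (b : 'I_m -> R),
    K = [set x | forall i, \sum_p a i p * x p <= b i].

Definition affine_map (g : (P -> R) -> (Q -> R)) : Prop :=
  exists (A : Q -> P -> R) (b : Q -> R),
    forall x q, g x q = \sum_p A q p * x p + b q.

Definition piecewise_linear (f : (P -> R) -> (Q -> R)) : Prop :=
  exists n (K : 'I_n -> set (P -> R)),
    \bigcup_i K i = setT /\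
    forall i, polyhedron (K i) /\
      exists2 g, affine_map g & forall x, K i x -> f x = g x.

End PiecewiseLinear.

(* Coordinates are 1-based, as in [a] = {1, ..., a}. *)
Definition inR (r s i j : nat) : bool := (1 <= i <= r)%N && (1 <= j <= s)%N.

(* i - j < r is written i < r + j to avoid truncated subtraction *)
Definition inRT (r s i j : nat) : bool :=
  [&& (1 <= i <= r + s - 1)%N, (1 <= j <= s)%N & (i < r + j)%N].

Definition inT (r s i j : nat) : bool := inRT r s i j && (s < i + j)%N.

(* the interval [(a1, a2), (b1, b2)] of RT_{r,s} *)
Definition interval_RT (r s a1 a2 b1 b2 i j : nat) : bool :=
  [&& inRT r s i j, (a1 <= i <= b1)%N & (a2 <= j <= b2)%N].

Definition inI (r s k i j : nat) : bool :=
  inT r k i j || interval_RT r s k k.+1 (r + k - 1) s i j.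

Definition inM (r s k i j : nat) : bool :=
  interval_RT r s k 1 (r + k) k.+1 i j.

(* The subposet of N^2 cut out by D, where D is a subset of RT_{r,s} or of
   R_{r,s}: for s > 0 the box {0..r+s-1} x {0..s} contains both. *)
Definition subposet (r s : nat) (D : rel nat) :=
  {p : 'I_(r + s) *p 'I_s.+1 | D p.1 p.2}.

Fact subposet_display : Order.disp_t. Proof. exact: Order.Disp tt tt. Qed.

HB.instance Definition _ r s D := Finite.on (subposet r s D).
HB.instance Definition _ r s D := SubType.on (subposet r s D).
HB.instance Definition _ r s D :=
  [SubChoice_isSubPOrder of subposet r s D by <: with subposet_display].

Notation poset_R r s := (subposet r s (inR r s)).
Notation poset_T r s := (subposet r s (inT r s)).
Notation poset_I r s k := (subposet r s (inI r s k)).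
Notation poset_M r s k := (subposet r s (inM r s k)).

Section Zeta.
Context {R : realType} {r s : nat}.

(* the entry x_{ij} (junk value 0 if (i, j) is not in D) *)
Definition entry {D : rel nat} (x : subposet r s D -> R) (i j : nat) : R :=
  if [pick p : subposet r s D | ((val p).1 == i :> nat) && ((val p).2 == j :> nat)]
  is Some p then x p else 0.

(* R^D -> R^D' by equality of coordinates *)
Definition restrict_to {D D' : rel nat} (x : subposet r s D -> R) :
  subposet r s D' -> R := fun p => entry x (val p).1 (val p).2.

Definition xbar (k : nat) (x : poset_I r s k.+1 -> R) : poset_M r s k -> R :=
  fun p => if ((val p).1 == k :> nat) && ((val p).2 == 1%N :> nat) then 0
           else restrict_to x p.

Definition zeta_step (k : nat) (x : poset_I r s k.+1 -> R) :
    poset_I r s k -> R := fun p =>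
  let i : nat := (val p).1 in let j : nat := (val p).2 in
  let y := psi (xbar x) in
  if (insub (val p) : option (poset_M r s k)) is Some p' then
    mins [seq y q | q <- enum [pred q : poset_M r s k | covers p' q]] - y p'
  else if (k.+1 < j)%N then entry x i.+1 j
  else entry x i j.+1.

(* zeta_1 \o ... \o zeta_n *)
Fixpoint zeta_comp (n : nat) : (poset_I r s n.+1 -> R) -> (poset_I r s 1 -> R) :=
  if n is n'.+1 then zeta_comp (n := n') \o zeta_step (k := n'.+1) else id.

(* For 0 < s, I_s and T_{r,s} (resp. I_1 and R_{r,s}) are the same set of
   points, given by different predicates; restrict_to identifies them. *)
Definition zeta : (poset_T r s -> R) -> (poset_R r s -> R) :=
  restrict_to \o zeta_comp (n := s.-1) \o restrict_to.

End Zeta.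

(* Main.v *)
Require Import Defs.
From Stdlib Require Morphisms.
From mathcomp Require Import all_boot all_order all_algebra.
From mathcomp Require Import all_classical all_reals all_analysis.
From mathcomp Require Import zify ring lra.

(** As [psi x p] is the largest weight of a chain ending at [p], the map [psi_inv]
    identifies the plane partitions of height [l] with the labelings by natural
    numbers whose heaviest maximal chain has weight [l].  So [zeta] has to be a
    bijection between such labelings which preserves the weight of the heaviest
    maximal chain.  A single [zeta_k] is invertible, since [z = zeta_k x] determines
    [y = psi xbar] by a recursion from the top of [M_k], but it does not preserve this
    weight.  It preserves the largest weight of the maximal chains of [I_k] that start
    at [(k, 1)] or meet the staircase [i + 1 = r + j] in one of the rows [2, ..., k];
    these are all maximal chains when [k] is [1] or [s].

    To see this, cut such a chain at the staircase.  The steps before the cut are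
    compared with paths in the old labeling translated by [(0, 1)] and the steps after
    the cut with paths translated by [(1, 0)].  Both comparisons are instances of one
    statement about longest paths: if [x] and [z] are the differences of [y] with its
    maximum over lower neighbours and its minimum over upper neighbours, then [z]-paths
    and translated [x]-paths from one side of a region to the opposite side have the
    same maximal weight. *)

Set Implicit Arguments.
Unset Strict Implicit.
Unset Printing Implicit Defensive.

Import Order.TTheory GRing.Theory Num.Theory.
Import numFieldNormedType.Exports.
Local Open Scope classical_set_scope.
Local Open Scope ring_scope.

(** * Longest paths *)

(** Allows rewriting with an equivalence inside a three-way disjunction, the form that the path
    recursions take. *)
#[local] Instance or3_iff_proper :
  Morphisms.Proper (Morphisms.respectful iff
    (Morphisms.respectful iff (Morphisms.respectful iff iff))) or3.
Proof.
move=> a a' Ha b b' Hb c c' Hc; split=> -[] H.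
- by constructor 1; apply/Ha.
- by constructor 2; apply/Hb.
- by constructor 3; apply/Hc.
- by constructor 1; apply/Ha.
- by constructor 2; apply/Hb.
- by constructor 3; apply/Hc.
Qed.

Section Reach.
Context {R : realFieldType}.
Implicit Types (D : rel nat) (x y z : nat -> nat -> R) (S : nat -> nat -> R -> Prop).

(* [reach D x S i j w]: a path of unit steps in D which ends at (i, j) has weight at
   least w, where S tells the values available on entering D.  Down-closed sets of
   reals play the role of elements of R with a bottom element -oo added. *)
Inductive reach D x S : nat -> nat -> R -> Prop :=
| reach_source i j w : D i j -> S i j (w - x i j) -> reach D x S i j w
| reach_right i j w : D i.+1 j -> reach D x S i j (w - x i.+1 j) ->
    reach D x S i.+1 j w
| reach_up i j w : D i j.+1 -> reach D x S i j (w - x i j.+1) ->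
    reach D x S i j.+1 w.

Lemma reach_in D x S i j w : reach D x S i j w -> D i j.
Proof. by case. Qed.

Lemma reachE D x S i j w : reach D x S i j w <->
  D i j /\ [\/ S i j (w - x i j),
               (0 < i)%N /\ reach D x S i.-1 j (w - x i j)
             | (0 < j)%N /\ reach D x S i j.-1 (w - x i j)].
Proof.
split.
  by case=> {}i {}j {}w Dij H; split=> //; [constructor 1 | constructor 2 | constructor 3].
case=> Dij [H|[i0 H]|[j0 H]]; first exact: reach_source.
  by case: i i0 Dij H => // i _; apply: reach_right.
by case: j j0 Dij H => // j _; apply: reach_up.
Qed.

Definition down_closed S := forall i j w w', w' <= w -> S i j w -> S i j w'.

Lemma reach_down D x S : down_closed S -> down_closed (reach D x S).
Proof.
move=> dS i j w w' le_w H; elim: H w' le_w => {i j w} i j w Dij H => [|IH|IH] w' le_w.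
- by apply: reach_source => //; apply: dS H; lra.
- by apply: reach_right => //; apply: IH; lra.
- by apply: reach_up => //; apply: IH; lra.
Qed.

(** * Exchanging two longest-path problems *)

Section Swap.
Variables (D : rel nat) (x y z : nat -> nat -> R) (S : nat -> nat -> R -> Prop).
Hypothesis dS : down_closed S.
Hypothesis D0l : forall v, D 0 v = false.
Hypothesis D0r : forall u, D u 0 = false.
Hypothesis Dtop : forall u v, D u v.+1 -> D u.+1 v -> D u.+1 v.+1.
Hypothesis Dbot : forall u v, D u v.+1 -> D u.+1 v -> D u v.
Hypothesis z_in : forall u v, D u v -> D u v.+1 ->
  z u v = Num.min (y u.+1 v) (y u v.+1) - y u v.
(** Here [x] is a difference labeling translated by one step in the first coordinate: [x u v.+1] is
    the difference taken at (u + 1, v + 1). So [y] may also be read one step outside [D]. *)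
Hypothesis x_in : forall u v, D u v -> D u v.+1 ->
  x u v.+1 = y u.+1 v.+1 - Num.max (y u v.+1) (y u.+1 v).
Hypothesis z_top : forall u v, D u v -> ~~ D u v.+1 -> z u v = y u.+1 v - y u v.
Hypothesis x_bot : forall u v, D u v.+1 -> ~~ D u v ->
  x u v.+1 = y u.+1 v.+1 - y u v.+1.
Hypothesis S_bot : forall u v w, S u v.+1 w -> ~~ D u v.

Let h := reach D x S.
Let h' := reach D z S.
Let q u v w := h u v (w + y u.+1 v).

Let hE u v w : h u.+1 v.+1 w <-> D u.+1 v.+1 /\
  [\/ S u.+1 v.+1 (w - x u.+1 v.+1), h u v.+1 (w - x u.+1 v.+1)
    | h u.+1 v (w - x u.+1 v.+1)].
Proof.
split; first by case/reachE=> Duv [H|[_ H]|[_ H]]; split=> //; constructor.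
case=> Duv H; apply/reachE; split=> //.
by case: H => H; [constructor 1 | constructor 2 | constructor 3].
Qed.

Let hE' u v w : h' u.+1 v.+1 w <-> D u.+1 v.+1 /\
  [\/ S u.+1 v.+1 (w - z u.+1 v.+1), h' u v.+1 (w - z u.+1 v.+1)
    | h' u.+1 v (w - z u.+1 v.+1)].
Proof.
split; first by case/reachE=> Duv [H|[_ H]|[_ H]]; split=> //; constructor.
case=> Duv H; apply/reachE; split=> //.
by case: H => H; [constructor 1 | constructor 2 | constructor 3].
Qed.

Let qN u v w : ~~ D u v -> ~ q u v w.
Proof. by move=> /negP nD /reach_in. Qed.

Let hN' u v w : ~~ D u v -> ~ h' u v w.
Proof. by move=> /negP nD /reach_in. Qed.

(** Let e and f be the unit steps in the first and second coordinate, p = (u + 1, v + 1), and write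
    Q, H, H' for [q], [h], [h']. Then [stepC] reads Q p = max (Q (p - e + f), H' p - min (y (p + e),
    y (p + f))). It is the bridge by which [stepA] climbs from p to p + f. *)
Let stepA u v := forall w, q u.+1 v.+1 w <->
  [\/ q u v.+1 w, h' u.+1 v (w + y u.+1 v.+1) | S u.+1 v.+1 (w + y u.+1 v.+1)].
Let stepB u v := forall w, q u v w <-> h' u v (w + y u.+1 v) \/ q u v.+1 w.
Let stepC u v := forall w, q u.+1 v.+1 w <->
  q u v.+2 w \/ h' u.+1 v.+1 (w + Num.min (y u.+2 v.+1) (y u.+1 v.+2)).

Let stepA_bot u v : D u.+1 v.+1 -> ~~ D u.+1 v -> stepA u v.
Proof.
move=> D1 D0 w; rewrite /q hE x_bot //.
have -> : w + y u.+2 v.+1 - (y u.+2 v.+1 - y u.+1 v.+1) = w + y u.+1 v.+1 by ring.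
split=> [[_ [] H]|[] H].
- by constructor 3.
- by constructor 1.
- by case/negP: D0; apply: reach_in H.
- by split=> //; constructor 2.
- by case: (hN' D0 H).
- by split=> //; constructor 1.
Qed.

(** By [stepB], Q (p - e) is the maximum of H' (p - e) - y p and Q (p - e + f). The terms in H' and
    the source term then combine into H' p by [z_in]. If p - e is outside [D], then so is p - e + f
    by [Dbot]. *)
Let stepC_A u v : D u.+1 v.+1 -> D u.+1 v.+2 -> stepA u v ->
  (D u v.+1 -> stepB u v.+1) -> stepC u v.
Proof.
move=> D1 D2 Auv Buv w; rewrite Auv hE' (z_in D1 D2).
set m := Num.min _ _.
have -> : w + m - (m - y u.+1 v.+1) = w + y u.+1 v.+1 by ring.
case: (boolP (D u v.+1)) => [D3|nD3].
  rewrite (Buv D3); split=> [[[H|H]|H|H]|[H|[_ []] H]].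
  - by right; split=> //; constructor 2.
  - by left.
  - by right; split=> //; constructor 3.
  - by right; split=> //; constructor 1.
  - by constructor 1; right.
  - by constructor 3.
  - by constructor 1; left.
  - by constructor 2.
split.
  by case=> [/(qN nD3)//|H|H]; right; split=> //; [constructor 3|constructor 1].
case=> [H|[_ [H|/(hN' nD3)//|H]]]; [|by constructor 3|by constructor 2].
by case/negP: nD3; apply: Dbot D1; apply: reach_in H.
Qed.

Let h'_min u v w a b : h' u v (w + Num.min a b) <->
  h' u v (w + a) \/ h' u v (w + b).
Proof.
have [le_ab|/ltW le_ba] := leP a b.
  split; first by left.
  by case=> // H; apply: reach_down H => //; lra.
split; first by right.
by case=> // H; apply: reach_down H => //; lra.
Qed.

(** Unfold H (p + f) and insert [stepC] for H p. With a = y (p + e) and b = y (p + f), the constants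
    cancel because max (a, b) + min (a, b) = a + b. *)
Let stepA_C u v : D u.+1 v.+1 -> D u.+1 v.+2 -> stepC u v -> stepA u v.+1.
Proof.
move=> D1 D2 Cuv w; rewrite /q hE (x_in D1 D2).
set a := y u.+2 v.+1; set b := y u.+1 v.+2; set t := y u.+2 v.+2.
have nS w' : ~ S u.+1 v.+2 w' by move=> /S_bot; rewrite D1.
have E1 w' : h u.+1 v.+1 w' <-> q u v.+2 (w' - a) \/
    h' u.+1 v.+1 (w' - a + Num.min a b).
  by rewrite -Cuv /q subrK.
have qd w1 w2 : w1 <= w2 -> q u v.+2 w2 -> q u v.+2 w1.
  by move=> le_w; apply: reach_down => //; lra.
have -> : w + t - (t - Num.max b a) = w + Num.max b a by ring.
have [le_ba|/ltW le_ab] := leP b a.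
  split=> [[_ [/nS//|H|/E1]]|[H|H|/nS//]].
  - by constructor 1; apply: reach_down H => //; lra.
  - rewrite addrK (min_idPr le_ba) => -[]; by [constructor 1 | constructor 2].
  - by split=> //; constructor 3; apply/E1; rewrite addrK; left.
  - split=> //; constructor 3; apply/E1; rewrite addrK (min_idPr le_ba); by right.
split=> [[_ [/nS//|H|/E1]]|[H|H|/nS//]].
- by constructor 1.
- rewrite (min_idPl le_ab) subrK => -[H|H]; last by constructor 2.
  by constructor 1; apply: qd H; lra.
- by split=> //; constructor 2.
- by split=> //; constructor 3; apply/E1; right; rewrite (min_idPl le_ab) subrK.
Qed.

(** If p + f is in [D], the minimum in [stepC] splits H' p - min (a, b) into H' p - a and H' p - b,
    and by [stepA] the latter joins Q (p - e + f) to form Q (p + f). Otherwise [z_top] replaces the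
    minimum by a, and [Dtop] excludes p - e + f. *)
Let stepB_A u v : D u.+1 v.+1 -> stepA u v -> (D u v.+1 -> stepB u v.+1) ->
  stepB u.+1 v.+1.
Proof.
move=> D1 Auv Buv w.
case: (boolP (D u.+1 v.+2)) => [D2|nD2].
  have Cuv := stepC_A D1 D2 Auv Buv.
  have nS w' : ~ S u.+1 v.+2 w' by move=> /S_bot; rewrite D1.
  rewrite (stepA_C D1 D2 Cuv) Cuv h'_min.
  split=> [[H|[H|H]]|[H|[H|H|/nS//]]].
  - by right; constructor 1.
  - by left.
  - by right; constructor 2.
  - by right; left.
  - by left.
  - by right; right.
rewrite Auv hE' (z_top D1 nD2).
have -> : w + y u.+2 v.+1 - (y u.+2 v.+1 - y u.+1 v.+1) = w + y u.+1 v.+1 by ring.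
have [D3|nD3] := boolP (D u v.+1).
  have nq w' : ~ q u v.+2 w'.
    by move=> /reach_in D4; case/negP: nD2; apply: Dtop.
  rewrite (Buv D3); split=> [[[H|/nq//]|H|H]|[[_ []]|/(qN nD2)//] H].
  - by left; split=> //; constructor 2.
  - by left; split=> //; constructor 3.
  - by left; split=> //; constructor 1.
  - by constructor 3.
  - by constructor 1; left.
  - by constructor 2.
split=> [[/(qN nD3)//|H|H]|[[_ [H|/(hN' nD3)//|H]]|/(qN nD2)//]].
- by left; split=> //; constructor 3.
- by left; split=> //; constructor 1.
- by constructor 3.
- by constructor 2.
Qed.

(* Writing H, H' for the two longest-path functions, e for a step in the first
   coordinate and f for a step in the second, Q p = H p - y (p + e) satisfies
     Q p = max (Q (p - e), H' (p - f) - y p)   and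
     Q p = max (H' p - y (p + e), Q (p + f));
   the second equation reads H = H' where p + f is outside of D. *)
Lemma reach_swap u v w : D u v -> ~~ D u v.+1 ->
  reach D z S u v w <-> reach D x S u v w.
Proof.
(* The outer induction is on the first coordinate. For a fixed one, [stepA] is carried upwards by
   [stepC] and starts afresh wherever the point below is outside [D]. *)
have B : forall u v, D u v -> stepB u v.
  elim=> [v'|{}u IHu]; first by rewrite D0l.
  have A : forall v, D u.+1 v.+1 -> stepA u v.
    elim=> [D1|v' IHv D1]; first by apply: stepA_bot => //; rewrite D0r.
    have [D2|nD2] := boolP (D u.+1 v'.+1); last exact: stepA_bot.
    by apply: stepA_C => //; apply: stepC_A => //; [apply: IHv | apply: IHu].
  case=> [|v']; first by rewrite D0r.
  by move=> D1; apply: stepB_A => //; [apply: A | apply: IHu].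
move=> D1 nD2; rewrite -/h -/h'; have := B _ _ D1 (w - y u.+1 v).
rewrite /q subrK => ->; split; [by left|case=> // /reach_in D3].
by rewrite D3 in nD2.
Qed.

End Swap.
End Reach.

(** * The invariant of a single step *)

Ltac region := unfold inI, inT, inM, inR, interval_RT, inRT in *; lia.

Section Neighbours.
Context {R : realFieldType}.
Implicit Types (D : rel nat) (y : nat -> nat -> R).

(* Junk value 0 when (i, j) has no neighbour in D on the relevant side. *)
Definition max_below D y i j : R :=
  if D i.-1 j then if D i j.-1 then Num.max (y i.-1 j) (y i j.-1) else y i.-1 j
  else if D i j.-1 then y i j.-1 else 0.

Definition min_above D y i j : R :=
  if D i.+1 j then if D i j.+1 then Num.min (y i.+1 j) (y i j.+1) else y i.+1 j
  else if D i j.+1 then y i j.+1 else 0.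

End Neighbours.

Section Step.
Context {R : realFieldType}.
Variables (r s : nat).

(** For 0 < k <= s <= r these points, as far as they lie in I_k, are its minimal elements. *)
Definition src_antidiag k i j (w : R) : Prop := (i + j = k.+1)%N /\ w <= 0.

Definition reach_any k (x : nat -> nat -> R) :=
  reach (inI r s k) x (src_antidiag k).

(** Paths that meet the staircase are encoded by making the staircase points sources, whose value is
    the weight of an arbitrary path to the left neighbour. *)
Definition src_boundary k x i j (w : R) : Prop :=
  [/\ i = k, j = 1%N & w <= 0] \/
  [/\ (1 < j <= k)%N, (i.+1 = r + j)%N & reach_any k x i.-1 j w].

Definition reach_boundary k x := reach (inI r s k) x (src_boundary k x).

Lemma src_antidiag_down k : down_closed (src_antidiag k).
Proof. by move=> i j w w' le_w [? ?]; split=> //; lra. Qed.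

Lemma reach_any_down k x : down_closed (reach_any k x).
Proof. exact/reach_down/src_antidiag_down. Qed.

Lemma reach_boundary_any k x i j w : (0 < k)%N ->
  reach_boundary k x i j w -> reach_any k x i j w.
Proof.
move=> k0; elim=> {i j w} [i j w Dij|i j w Dij _|i j w Dij _]; last 2 first.
- exact: reach_right.
- exact: reach_up.
case=> [[ik j1 w0]|[j2 ij]]; first by apply: reach_source => //; split=> //; lia.
by case: i Dij ij => // i Dij _; apply: reach_right.
Qed.

(* The only step into an element of the staircase i + 1 = r + j is horizontal. *)
Lemma reach_any_stair k x i j w : (0 < k <= r)%N -> (i.+1 = r + j)%N -> (j <= k)%N ->
  reach_any k x i j w -> reach_boundary k x i j w.
Proof.
move=> k0 ij jk; case: (ltngtP j 1) => [j0 /reach_in|j2|j1].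
- by region.
- case/reachE=> Dij [[ij' w0]|[i0 H]|[j0 /reach_in]].
  + by apply: reach_source => //; left; split=> //; lia.
  + by apply: reach_source => //; right; split=> //; lia.
  + by region.
(* A path that ends in row 1 is horizontal, hence begins at (k, 1). *)
move=> H; elim: H j1 {ij jk} => {i j w} [i j w Dij [ij w0] j1|i j w Dij _ IH j1|i j w Dij].
- by apply: reach_source => //; left; split=> //; lia.
- by apply: reach_right => //; apply: IH.
- by move=> /reach_in; region.
Qed.

Variable k : nat.
Hypotheses (k_gt0 : (0 < k)%N) (k_lt_s : (k < s)%N) (s_le_r : (s <= r)%N).
Variables x y z : nat -> nat -> R.
Local Notation M := (inM r s k).

Hypothesis yE : forall i j, M i j -> ~~ ((i == k) && (j == 1%N)) ->
  y i j = x i j + max_below M y i j.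
Hypothesis zE : forall i j, M i j -> inI r s k i j ->
  z i j = min_above M y i j - y i j.
Hypothesis z_upper : forall i j, inI r s k i j -> ~~ M i j -> (k.+1 < j)%N ->
  z i j = x i.+1 j.
Hypothesis z_left : forall i j, inI r s k i j -> ~~ M i j -> (j <= k.+1)%N ->
  z i j = x i j.+1.

(* Before its last element on the staircase a path is compared in DL (written with
   the two coordinates exchanged), afterwards in DT. *)
Let DL u v := (u <= k)%N && M v u.
Let DT i j := M i j && M i.+1 j.

Ltac reg := unfold DL, DT in *; region.

(** Rows 1 to k of M_k are entered only through its first column: at the minimal element (k, 1), or
    from the left out of column k - 1. *)
Let SL u v (w : R) : Prop :=
  v = k /\ ((u = 1%N /\ w <= 0) \/ reach_any k z k.-1 u w).
(** The second alternative is the vertical step from the staircase point (i, j - 1) of row j - 1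
    into [DT]. *)
Let ST i j (w : R) : Prop :=
  [/\ i = k, j = 1%N & w <= 0] \/
  [/\ (1 < j <= k.+1)%N, (i.+2 = r + j)%N & reach_any k z i j.-1 w].

Let zL u v := z v u.
Let xL u v := x v u.+1.
Let xT i j := x i.+1 j.

(** Exchanging the coordinates makes the translation by (0, 1) a step in the first one. The side of
    [DL] opposite to its sources is the staircase. *)
Let swapL u v w : (0 < u <= k)%N -> (v.+1 = r + u)%N ->
  reach DL zL SL u v w <-> reach DL xL SL u v w.
Proof.
move=> u0 uv; apply: (@reach_swap _ DL xL (fun u v => y v u) zL).
- move=> i j w1 w2 le_w [-> [[-> w0]|H]]; split=> //; [left; split=> //; lra | right].
  exact: reach_any_down H.
- by move=> v'; reg.
- by move=> u'; reg.
- by move=> u' v'; reg.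
- by move=> u' v'; reg.
- move=> u' v' D1 D2; rewrite /zL zE /min_above; try by reg.
  by rewrite !ifT; try reg; rewrite minC.
- move=> u' v' D1 D2; rewrite /xL [in RHS]yE /max_below; try by reg.
  by rewrite !ifT /=; try reg; rewrite maxC; ring.
- move=> u' v' D1 D2; rewrite /zL zE /min_above; try by reg.
  by rewrite ifF ?ifT //; reg.
- move=> u' v' D1 D2; rewrite /xL [in RHS]yE /max_below; try by reg.
  by rewrite ifF ?ifT /=; try ring; reg.
- by move=> u' v' w' [vk _]; reg.
- by reg.
- by reg.
Qed.


(** The translation is now by (1, 0), and the side opposite to the sources is row k + 1, the top row
    of M_k. *)
Let swapT i w : (k <= i < r + k)%N ->
  reach DT z ST i k.+1 w <-> reach DT xT ST i k.+1 w.
Proof.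
move=> ik; apply: (@reach_swap _ DT xT y z).
- move=> i1 j w1 w2 le_w [[-> -> w0]|[j2 ij H]]; first by left; split=> //; lra.
  by right; split=> //; apply: reach_any_down H.
- by move=> v'; reg.
- by move=> u'; reg.
- by move=> u' v'; reg.
- by move=> u' v'; reg.
- move=> u' v' D1 D2; rewrite zE /min_above; try by reg.
  by rewrite !ifT; try reg.
- move=> u' v' D1 D2; rewrite /xT [in RHS]yE /max_below; try by reg.
  by rewrite !ifT /=; try reg; ring.
- move=> u' v' D1 D2; rewrite zE /min_above; try by reg.
  by rewrite ifT ?ifF //; reg.
- move=> u' v' D1 D2; rewrite /xT [in RHS]yE /max_below; try by reg.
  by rewrite ifT ?ifF /=; try ring; reg.
- by move=> u' v' w' [[]|[]] *; reg.
- by reg.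
- by reg.
Qed.

(** To the left of M_k, z is x moved down by one row, and the antidiagonal of sources moves along.
    The next lemma is the converse. *)
Let shiftL1 i j w : reach_any k z i j w -> (i < k)%N -> reach_any k.+1 x i j.+1 w.
Proof.
elim=> {i j w} i j w Dij.
- move=> [ij w0] ik; rewrite z_left in w0; try by reg.
  by apply: reach_source; [reg | split; lia].
- move=> _ IH ik; rewrite z_left in IH; try by reg.
  by apply: reach_right; [reg | apply: IH; lia].
- move=> H IH ik; rewrite z_left in IH; try by reg.
  by apply: reach_up; [reg | apply: IH].
Qed.

Let shiftL2 i j w : reach_any k.+1 x i j w -> (i < k)%N -> reach_any k z i j.-1 w.
Proof.
elim=> {i j w} i j w Dij.
- move=> [ij w0] ik; apply: reach_source; first by reg.
  have -> : z i j.-1 = x i j by rewrite z_left; try reg; congr x; reg.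
  by split=> //; reg.
- move=> _ IH ik; apply: reach_right; first by reg.
  have -> : z i.+1 j.-1 = x i.+1 j by rewrite z_left; try reg; congr x; reg.
  by apply: IH; lia.
- case: j Dij => [|j] Dij /[dup] /reach_in Dij' _ IH ik; first by reg.
  by apply: reach_up; [reg | rewrite z_left; [apply: IH | reg..]].
Qed.

Let reachL_z u v w : DL u v -> reach DL zL SL u v w <-> reach_any k z v u w.
Proof.
move=> Duv; split.
  move=> H; elim: H {Duv} => {u v w} [u v w Duv [vk [[u1 w0]|H]]|u v w Duv _ IH|u v w Duv _ IH].
  - by apply: reach_source; [reg | split; [lia|]].
  - case: v Duv vk H => [|v] Duv vk; first by reg.
    have -> : k.-1 = v by lia.
    by move=> H; apply: reach_right => //; reg.
  - by apply: reach_up => //; reg.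
  - by apply: reach_right => //; reg.
move=> H; elim: H Duv => {u v w} i j w Dij.
- move=> [ij w0] Dji; apply: reach_source => //; split; first by reg.
  by left; split=> //; reg.
- move=> H IH Dji; have [Dji'|nDji] := boolP (DL j i).
    by apply: reach_up => //; apply: IH.
  apply: reach_source => //; have ik : i.+1 = k by reg.
  by split=> //; right; have -> : k.-1 = i by lia.
- move=> /[dup] /reach_in Dij' _ IH Dji; apply: reach_right => //.
  by apply: IH; reg.
Qed.

Let reachL_x u v w : reach DL xL SL u v w -> reach_any k.+1 x v u.+1 w.
Proof.
elim=> {u v w} [u v w Duv [vk [[u1 w0]|H]]|u v w Duv _ IH|u v w Duv _ IH].
(* The source (k, 1) is translated to (k, 2), on the antidiagonal of sources of I_(k+1). *)
- by apply: reach_source; [reg | split; [lia|]].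
- rewrite vk in Duv H *; move/shiftL1: H; rewrite prednK // => /(_ (leqnn _)).
  case: k k_gt0 Duv => // k' _ Duv H; apply: reach_right => //; reg.
- by apply: reach_up => //; reg.
- by apply: reach_right => //; reg.
Qed.

Let reach_stair i j w : (0 < j <= k)%N -> (i.+1 = r + j)%N ->
  reach_any k z i j w <-> reach DL xL SL j i w.
Proof. by move=> j0 ij; rewrite -swapL // -reachL_z //; reg. Qed.

(** A path in the old labeling is followed in [DL], one row lower, until it meets the staircase, and
    from then on in [DT], one column to the left. A path that starts at (k + 1, 1) is in [DT] from
    the beginning. *)
Let reach_x_split i j w : reach_any k.+1 x i j w -> (k <= i)%N -> (j <= k.+1)%N ->
  ((1 < j)%N /\ reach DL xL SL j.-1 i w) \/ ((k < i)%N /\ reach DT xT ST i.-1 j w).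
Proof.
elim=> {i j w} i j w Dij.
- move=> [ij w0] ki jk; have [j1|j1] := leqP j 1.
    right; split; first by reg.
    apply: reach_source; first by reg.
    by rewrite /xT prednK; [left; split=> //; reg | reg].
  left; split=> //; apply: reach_source; first by reg.
  rewrite /xL prednK; last by reg.
  by split; [reg | left; split=> //; reg].
- move=> H IH ki jk; have [ki'|ki'] := leqP k i.
    case: (IH ki' jk) => -[j1 H'].
      have [D1|nD1] := boolP (DL j.-1 i.+1).
        by left; split=> //; apply: reach_up => //; rewrite /xL prednK //; reg.
      (* Here (i + 1, j) and (i, j - 1) are both on the staircase. The path changes from [DL] to
         [DT], and [reach_stair] turns its weight so far into that of a path in z. *)
      right; split; first by lia.
      have D2 : DL j.-1 i by apply: reach_in H'.
      apply: reach_source; first by reg.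
      right; split; [reg | reg | apply/reach_stair; [reg..|]].
      exact: H'.
    right; split; first by lia.
    case: i j1 H' Dij {IH H ki ki'} => // i j1 H' Dij.
    by apply: reach_right => //; reg.
  have ik : i.+1 = k by lia.
  have Dij' := reach_in H.
  left; split; first by reg.
  apply: reach_source; first by reg.
  rewrite /xL prednK; last by reg.
  split=> //; right; have -> : k.-1 = i by lia.
  by apply: shiftL2; [|lia].
- move=> /[dup] /reach_in Dij' _ IH ki jk; case: (IH ki (ltnW jk)) => -[j1 H].
    left; split; first by lia.
    case: j j1 H Dij jk Dij' {IH} => // j j1 H Dij jk Dij'.
    by apply: reach_right; [reg | exact: H].
  right; split=> //; apply: reach_up; first by reg.
  by rewrite /xT prednK //; lia.
Qed.

Let reachT_any i j w : reach DT z ST i j w -> reach_any k z i j w.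
Proof.
elim=> {i j w} i j w Dij.
- case=> [[ik j1 w0]|[j2 ij H]]; first by apply: reach_source; [reg | split; lia].
  by case: j Dij j2 ij H => // j Dij j2 ij H; apply: reach_up; [reg | exact: H].
- by move=> _ IH; apply: reach_right; [reg | exact: IH].
- by move=> _ IH; apply: reach_up; [reg | exact: IH].
Qed.

(** A staircase point has no right neighbour, so a path leaves the staircase upwards, and this step
    leads into [DT]. *)
Let reach_z_split i j w : reach_boundary k z i j w -> (j <= k.+1)%N ->
  [/\ (j <= k)%N, (i.+1 = r + j)%N & reach_any k z i j w] \/ reach DT z ST i j w.
Proof.
elim=> {i j w} i j w Dij.
- case=> [[ik j1 w0]|[j2 ij H]] jk.
    by right; apply: reach_source; [reg | left; split].
  left; split=> //; first by reg.
  by case: i Dij ij H => // i Dij ij H; apply: reach_right.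
- move=> /[dup] /reach_in Dij' _ IH jk; case: (IH jk) => [[jk' ij]|H]; first by reg.
  have Dij'' := reach_in H.
  have [D1|nD1] := boolP (DT i.+1 j); first by right; apply: reach_right.
  by left; split; [reg | reg | apply: reach_right => //; apply: reachT_any].
- move=> /[dup] /reach_in Dij' _ IH jk; right; case: (IH (ltnW jk)) => [[jk' ij H]|H].
    by apply: reach_source; [reg | right; split=> //; reg].
  have Dij'' := reach_in H.
  by apply: reach_up => //; reg.
Qed.

Let reachT_z i j w : reach DT z ST i j w -> reach_boundary k z i j w.
Proof.
elim=> {i j w} i j w Dij.
- case=> [[ik j1 w0]|[j2 ij H]]; first by apply: reach_source; [reg | left].
  case: j Dij j2 ij H => // j Dij j2 ij H; apply: reach_up; first by reg.
  by apply: reach_any_stair H; reg.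
- by move=> _ IH; apply: reach_right; [reg | exact: IH].
- by move=> _ IH; apply: reach_up; [reg | exact: IH].
Qed.

Let reachT_x1 i j w : reach DT xT ST i j w -> reach_boundary k.+1 x i.+1 j w.
Proof.
elim=> {i j w} i j w Dij.
- case=> [[ik j1 w0]|[j2 ij H]]; apply: reach_source; try by reg.
    by left; split=> //; lia.
  right; split=> //.
  case: j Dij j2 ij H => // j Dij j2 ij H; apply: reachL_x.
  by apply/reach_stair => //; reg.
- by move=> _ IH; apply: reach_right; [reg | exact: IH].
- by move=> _ IH; apply: reach_up; [reg | exact: IH].
Qed.

Let reachT_x2 i j w : reach_boundary k.+1 x i j w -> (j <= k.+1)%N ->
  (0 < i)%N /\ reach DT xT ST i.-1 j w.
Proof.
elim=> {i j w} i j w Dij.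
- case=> [[ik j1 w0]|[j2 ij H]] jk.
    split; first by lia.
    by apply: reach_source; [reg | rewrite /xT prednK; [left; split=> //|]; lia].
  split; first by reg.
  case: i Dij ij H => // i Dij ij H.
  have Dij' := reach_in H.
  (* The path to the left neighbour of the staircase point either comes through [DL], which gives a
     source of [DT], or is already in [DT]. *)
  case: (reach_x_split H) => [||[_ H']|[ik H']]; try by reg.
    apply: reach_source; first by reg.
    right; split; [reg | reg |].
    by apply/reach_stair; [reg..|exact: H'].
  case: i ik H' Dij ij H Dij' => // i ik H' Dij ij H Dij'.
  by apply: reach_right; [reg | exact: H'].
- move=> _ IH jk; split=> //; case: (IH jk) => i0 H.
  have Dij' := reach_in H.
  by case: i i0 H Dij Dij' {IH} => // i i0 H Dij Dij'; apply: reach_right; [reg | exact: H].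
- move=> _ IH jk; case: (IH (ltnW jk)) => i0 H; split=> //.
  have Dij' := reach_in H.
  by apply: reach_up; [reg | rewrite /xT prednK].
Qed.

Let reach_boundary_row i w : (k <= i < r + k)%N ->
  reach_boundary k z i k.+1 w <-> reach_boundary k.+1 x i.+1 k.+1 w.
Proof.
move=> ik; split=> H.
  case: (reach_z_split H (leqnn _)) => [[]|]; first by lia.
  by move/(swapT w ik)/reachT_x1.
by case: (reachT_x2 H (leqnn _)) => _ /(swapT w ik)/reachT_z.
Qed.

(** Above row k + 1 the two labelings differ only by the translation by (1, 0), so the equivalence
    spreads upwards from row k + 1. *)
Let reach_boundary_upper i j w : (k <= i < r + k)%N -> (k < j <= s)%N ->
  reach_boundary k z i j w <-> reach_boundary k.+1 x i.+1 j w.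
Proof.
have [n le_n] := ubnP (i + j); elim: n i j w le_n => // n IHn i j w le_n ik.
rewrite leq_eqVlt => /andP[/orP[/eqP <- _|jk js]]; first exact: reach_boundary_row.
case: j jk js le_n => // j jk js le_n.
have Dz : inI r s k i j.+1 by reg.
have Dx : inI r s k.+1 i.+1 j.+1 by reg.
split=> /reachE[_] H; apply/reachE; split=> //; move: H; rewrite z_upper //; try by reg.
  case=> [[[]|[]]|[i0 H]|[_ H]]; try by reg.
    have Dij := reach_in H; case: i i0 ik le_n Dz Dx H Dij => // i _ ik le_n Dz Dx H Dij.
    by constructor 2; split=> //; apply/IHn => //; reg.
  by constructor 3; split=> //; apply/IHn => //; reg.
case=> [[[]|[]]|[i0 H]|[_ H]]; try by reg.
  have Dij := reach_in H.
  case: i i0 ik le_n Dz Dx H Dij => [|i] i0 ik le_n Dz Dx H Dij; first by reg.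
  by constructor 2; split=> //; apply/IHn => //; reg.
by constructor 3; split=> //; apply/IHn => //; reg.
Qed.

(** The two end points are the greatest elements of I_k and I_(k+1). *)
Lemma reach_boundary_step w :
  reach_boundary k z (r + k - 1) s w <-> reach_boundary k.+1 x (r + k) s w.
Proof.
rewrite reach_boundary_upper; try lia.
by have -> : (r + k - 1).+1 = (r + k)%N by lia.
Qed.

End Step.

(** * Finite posets and psi *)

Section MaxMinTheory.
Context {R : realType}.
Implicit Types (v : seq R) (a : R).

Lemma maxs_nil : maxs [::] = 0 :> R. Proof. exact: big_nil. Qed.

Lemma maxs_ge v a : a \in v -> a <= maxs v.
Proof. by move=> av; exact: (@le_bigmax_seq _ _ _ v _ a xpredT id av). Qed.

Lemma maxs_in v : v != [::] -> maxs v \in v.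
Proof.
move=> v0; rewrite /maxs big_seq; elim/big_ind: _ => //.
- by case: v v0 => // a v _; rewrite mem_head.
- by move=> a b ? ?; case: leP.
Qed.

Lemma maxs_eq v a : a \in v -> (forall b, b \in v -> b <= a) -> maxs v = a.
Proof.
move=> av ub; apply/eqP; rewrite eq_le maxs_ge // ub //.
by apply: maxs_in; case: v av {ub}.
Qed.

Lemma mins_le v a : a \in v -> mins v <= a.
Proof. by move=> av; exact: (@ge_bigmin_seq _ _ _ v _ a xpredT id av). Qed.

Lemma mins_in v : v != [::] -> mins v \in v.
Proof.
move=> v0; rewrite /mins big_seq; elim/big_ind: _ => //.
- by case: v v0 => // a v _; rewrite mem_head.
- by move=> a b ? ?; case: leP.
Qed.

Lemma mins_eq v a : a \in v -> (forall b, b \in v -> a <= b) -> mins v = a.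
Proof.
move=> av lb; apply/eqP; rewrite eq_le mins_le // lb //.
by apply: mins_in; case: v av {lb}.
Qed.

End MaxMinTheory.

Section PosetTheory.
Context {d : Order.disp_t} {P : finPOrderType d}.
Implicit Types (p q : P) (c : seq P).

Lemma poset_ind (Q : P -> Prop) :
  (forall p, (forall q, (q < p)%O -> Q q) -> Q p) -> forall p, Q p.
Proof.
move=> IH p; have [n] := ubnP #|[pred q | (q < p)%O]|.
elim: n p => // n IHn p; rewrite ltnS => le_n; apply: IH => q lt_qp.
apply: IHn; apply: leq_trans le_n; apply: proper_card.
apply/fintype.properP; split; last by exists q; rewrite !inE ?lt_qp ?ltxx.
by apply/fintype.subsetP => z; rewrite !inE => /lt_trans; apply.
Qed.

Lemma covers_lt q p : covers q p -> (q < p)%O.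
Proof. by case/andP. Qed.

Lemma exists_cover q p : (q < p)%O -> exists2 q', (q <= q')%O & covers q' p.
Proof.
move=> lt_qp.
have q_ok : (q <= q)%O && (q < p)%O by rewrite lexx.
(* An element of [q, p) with as many elements below it as possible is maximal in [q, p). *)
case: (@arg_maxnP _ q [pred z | (q <= z)%O && (z < p)%O]
  (fun z => #|[pred t | (t < z)%O]|) q_ok) => q' /andP[le_qq' lt_q'p] q'_max.
exists q' => //; rewrite /covers lt_q'p; apply/forallP => z; apply/negP => /andP[lt1 lt2].
have := q'_max z; rewrite /= lt2 (le_trans le_qq' (ltW lt1)) => /(_ isT).
rewrite leqNgt => /negP[]; apply: proper_card; apply/fintype.properP; split.
  by apply/fintype.subsetP => t; rewrite !inE => /lt_trans; apply.
by exists q'; rewrite !inE ?lt1 ?ltxx.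
Qed.

Lemma covers_minimal q p : covers q p -> minimal p = false.
Proof. by move=> /covers_lt lt_qp; apply/negP => /forallP/(_ q); rewrite lt_qp. Qed.

Lemma minimalPn p : ~~ minimal p -> exists q, covers q p.
Proof.
by move=> /forallPn[q /negPn/exists_cover[q' _ H]]; exists q'.
Qed.

Lemma saturated_chain_to1 p : minimal p -> saturated_chain_to p [:: p].
Proof. by move=> p_min; rewrite /= p_min eqxx. Qed.

Lemma saturated_chain_to_rcons q p c : saturated_chain_to q c -> covers q p ->
  saturated_chain_to p (rcons c p).
Proof.
case: c => // a c /and3P[a_min ac /eqP <-] cov.
by rewrite /= a_min rcons_path ac cov last_rcons eqxx.
Qed.

Lemma saturated_chain_to_inv p c : saturated_chain_to p c ->
  (c = [:: p] /\ minimal p) \/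
  exists q c', [/\ c = rcons c' p, covers q p & saturated_chain_to q c'].
Proof.
case: c => // a c /and3P[a_min]; case/lastP: c => [_ /eqP <-|c b].
  by left.
rewrite last_rcons rcons_path => /andP[ac cov] /eqP <-; right.
by exists (last a c), (a :: c); rewrite rcons_cons /= a_min ac eqxx.
Qed.

Lemma saturated_chain_ex p : exists c, saturated_chain_to p c.
Proof.
elim/poset_ind: p => p IH; have [p_min|/minimalPn[q cov]] := boolP (minimal p).
  by exists [:: p]; apply: saturated_chain_to1.
have [c sat_c] := IH q (covers_lt cov).
by exists (rcons c p); apply: saturated_chain_to_rcons cov.
Qed.

Lemma saturated_chain_size p c : saturated_chain_to p c -> (size c <= #|P|)%N.
Proof.
case: c => // a c /and3P[_ ac _].
have lt_c : sorted <%O (a :: c) by apply: sub_path ac => u v; apply: covers_lt.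
have /card_uniqP <- := sorted_uniq lt_trans ltxx lt_c.
exact: max_card.
Qed.

Context {R : realType}.
Implicit Types (x y : P -> R).

Lemma psi_ge x p c : saturated_chain_to p c -> \sum_(q <- c) x q <= psi x p.
Proof.
move=> sat_c; apply: maxs_ge; apply/mapP.
by exists (Bseq (saturated_chain_size sat_c)); rewrite ?mem_enum.
Qed.

Lemma psi_chain x p : exists2 c, saturated_chain_to p c & psi x p = \sum_(q <- c) x q.
Proof.
have [c sat_c] := saturated_chain_ex p.
have : psi x p \in [seq \sum_(q <- (c : seq P)) x q
    | c : #|P|.-bseq P <- enum [pred c : #|P|.-bseq P | saturated_chain_to p c]].
  apply: maxs_in; rewrite -size_eq0 size_map -cardE -lt0n; apply/card_gt0P.
  by exists (Bseq (saturated_chain_size sat_c)).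
by case/mapP => c'; rewrite mem_enum => sat_c' ->; exists c'.
Qed.

Lemma enum_covers_nil p : minimal p -> enum [pred q | covers q p] = [::].
Proof.
move=> p_min; apply/eqP; rewrite -size_eq0 -cardE; apply/pred0P => q /=.
by apply/negP => /covers_minimal; rewrite p_min.
Qed.

(** Remove the last element of a heaviest chain. The default value 0 of [maxs] on the empty list
    lets the same formula serve for minimal elements. *)
Lemma psi_rec x p :
  psi x p = x p + maxs [seq psi x q | q <- enum [pred q | covers q p]].
Proof.
have [p_min|p_nmin] := boolP (minimal p).
  rewrite enum_covers_nil // maxs_nil addr0.
  have [c /saturated_chain_to_inv[[-> _]|[q [c' [_ /covers_minimal nmin _]]]] ->] :=
    psi_chain x p.
    by rewrite big_seq1.
  by rewrite nmin in p_min.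
apply/eqP; rewrite eq_le; apply/andP; split.
  have [c /saturated_chain_to_inv[[_ pm]|[q [c' [-> cov sat_c]]]] ->] := psi_chain x p.
    by rewrite pm in p_nmin.
  rewrite -cats1 big_cat big_seq1 /= addrC lerD2l (le_trans (psi_ge x sat_c)) //.
  by apply/maxs_ge/map_f; rewrite mem_enum.
set v := map _ _; have v0 : v != [::].
  have [q cov] := minimalPn p_nmin.
  by rewrite -size_eq0 size_map -cardE -lt0n; apply/card_gt0P; exists q.
have /mapP[q] := maxs_in v0; rewrite mem_enum => cov ->.
have [c sat_c ->] := psi_chain x q.
have := psi_ge x (saturated_chain_to_rcons sat_c cov).
by rewrite -cats1 big_cat big_seq1 /= addrC.
Qed.

Lemma psi_invE y p :
  psi_inv y p = y p - maxs [seq y q | q <- enum [pred q | covers q p]].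
Proof.
rewrite /psi_inv; case: ifP => // p_min.
by rewrite enum_covers_nil // maxs_nil subr0.
Qed.

Lemma psiK : cancel (@psi R d P) psi_inv.
Proof. by move=> x; apply/funext => p; rewrite psi_invE {1}psi_rec addrK. Qed.

Lemma psi_invK : cancel (@psi_inv R d P) psi.
Proof.
move=> y; apply/funext; elim/poset_ind => p IH.
rewrite psi_rec psi_invE; set v := map _ _; set v' := map _ _.
suff -> : v' = v by rewrite subrK.
by apply/eq_in_map => q; rewrite mem_enum => /covers_lt; apply: IH.
Qed.

Lemma maxs_nat v : {in v, forall a : R, a \is a Num.nat} -> maxs v \is a Num.nat.
Proof.
by move=> natv; case: (eqVneq v [::]) => [->|/maxs_in/natv //]; rewrite maxs_nil rpred0.
Qed.

Lemma psi_nat x : (forall p, x p \is a Num.nat) -> forall p, psi x p \is a Num.nat.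
Proof.
move=> natx; elim/poset_ind => p IH; rewrite psi_rec rpredD // maxs_nat // => a.
by case/mapP => q; rewrite mem_enum => /covers_lt/IH natq ->.
Qed.

Lemma psi_homo x : (forall p, 0 <= x p) -> {homo psi x : q p / (q <= p)%O >-> q <= p}.
Proof.
move=> x0 q; elim/poset_ind => p IH; rewrite le_eqVlt => /predU1P[->//|].
case/exists_cover => q' le_qq' cov; apply: le_trans (IH q' (covers_lt cov) le_qq') _.
rewrite [leRHS]psi_rec -[leLHS]add0r lerD //.
by apply/maxs_ge/map_f; rewrite mem_enum.
Qed.

(** Monotonicity of [y] amounts to nonnegative differences along covers, and the greatest element
    carries the maximal label. *)
Lemma plane_partitionsE t l y : (forall p, (p <= t)%O) ->
  plane_partitions l y <-> (forall p, psi_inv y p \is a Num.nat) /\ y t = l%:R.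
Proof.
move=> t_max; split=> [[naty homoy le_l [p yp]]|[natx yt]].
  split; last by apply/eqP; rewrite eq_le le_l -yp homoy.
  move=> {yp}p; rewrite psi_invE; set v := map _ _.
  have natv : {in v, forall a, a \is a Num.nat} by move=> a /mapP[q _ ->].
  rewrite natrEint rpredB ?intr_nat ?maxs_nat // subr_ge0.
  case: (eqVneq v [::]) => [->|/maxs_in/mapP[q]]; first by rewrite maxs_nil natr_ge0.
  by rewrite mem_enum => cov ->; apply/homoy/ltW/covers_lt.
have x0 p : 0 <= psi_inv y p by apply: natr_ge0.
have homoy : {homo y : q p / (q <= p)%O >-> q <= p}.
  by rewrite -[y]psi_invK; apply: psi_homo.
split=> //; [by rewrite -[y]psi_invK; apply: psi_nat | by move=> p; rewrite -yt homoy |].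
by exists t.
Qed.

End PosetTheory.

(** * Subposets of the grid *)

Section Points.
Context {r s : nat} {D : rel nat}.
Implicit Types p q : subposet r s D.

Lemma subposet_eq p q : (val p).1 = (val q).1 :> nat -> (val p).2 = (val q).2 :> nat ->
  p = q.
Proof.
move=> e1 e2; apply: val_inj; case: (val p) (val q) e1 e2 => [a b] [a' b'] /= e1 e2.
by congr pair; apply: val_inj.
Qed.

Lemma subposet_leE p q :
  (p <= q)%O = ((val p).1 <= (val q).1)%N && ((val p).2 <= (val q).2)%N.
Proof. by []. Qed.

Lemma subposet_ltE p q : (p < q)%O =
  [&& (val p).1 <= (val q).1, (val p).2 <= (val q).2
    & (val p).1 + (val p).2 < (val q).1 + (val q).2]%N.
Proof.
rewrite lt_neqAle subposet_leE; case: eqVneq => [->|neq]; first by rewrite ltnn !andbF.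
rewrite andTb; apply/idP/idP; last by case/and3P => -> ->.
move=> /andP[le1 le2]; rewrite le1 le2 !andTb; rewrite ltnNge; apply: contra neq => le_sum.
by apply/eqP/subposet_eq; lia.
Qed.

Lemma subposet_in p : D (val p).1 (val p).2. Proof. exact: (valP p). Qed.

Lemma subposet_ex i j : D i j -> (i < r + s)%N -> (j <= s)%N ->
  exists p, (val p).1 = i :> nat /\ (val p).2 = j :> nat.
Proof.
move=> Dij lt_i le_j.
by exists (exist (fun p : 'I_(r + s) *p 'I_s.+1 => D p.1 p.2)
  (Ordinal lt_i, Ordinal (le_j : (j < s.+1)%N)) Dij).
Qed.

Context {R : realType}.
Implicit Types x y : subposet r s D -> R.

Lemma entryE x p i j : (val p).1 = i :> nat -> (val p).2 = j :> nat -> entry x i j = x p.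
Proof.
move=> <- <-; rewrite /entry; case: pickP => [q /andP[/eqP e1 /eqP e2]|/(_ p)].
  by congr x; apply: subposet_eq.
by rewrite !eqxx.
Qed.

Lemma entry_val x p : entry x (val p).1 (val p).2 = x p.
Proof. exact: entryE. Qed.

End Points.

Definition grid_region r s (D : rel nat) :=
  forall i j, D i j -> [&& 0 < i, i < r + s, 0 < j & j <= s]%N.

(* In such a region every cover relation is a unit step. *)
Definition unit_steps (D : rel nat) := forall i j i' j', D i j -> D i' j' ->
  (i <= i')%N -> (j <= j')%N -> (i + j < i' + j')%N ->
  (i < i')%N /\ D i.+1 j \/ (j < j')%N /\ D i j.+1.

Section Covers.
Context {R : realType} {r s : nat} {D : rel nat}.
Hypotheses (D_grid : grid_region r s D) (D_unit : unit_steps D).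
Implicit Types (p q : subposet r s D) (x y : subposet r s D -> R).

Lemma subposet_coversE p q : covers p q =
  ((val p).1.+1 == (val q).1 :> nat) && ((val p).2 == (val q).2 :> nat)
  || ((val p).1 == (val q).1 :> nat) && ((val p).2.+1 == (val q).2 :> nat).
Proof.
rewrite /covers subposet_ltE; apply/idP/idP.
  case/andP => /and3P[le1 le2 lt_sum] /forallP no_z.
  have [[lt1 D1]|[lt2 D1]] := D_unit (subposet_in p) (subposet_in q) le1 le2 lt_sum.
    have /and4P[_ g2 _ g4] := D_grid D1.
    have [z [z1 z2]] := subposet_ex D1 g2 g4.
    have := no_z z; rewrite !subposet_ltE; lia.
  have /and4P[_ g2 _ g4] := D_grid D1.
  have [z [z1 z2]] := subposet_ex D1 g2 g4.
  have := no_z z; rewrite !subposet_ltE; lia.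
move=> pq; apply/andP; split; first by lia.
by apply/forallP => z; rewrite !subposet_ltE; lia.
Qed.

Lemma subposet_at i j : D i j ->
  exists p, (val p).1 = i :> nat /\ (val p).2 = j :> nat.
Proof. by move=> /[dup] /D_grid/and4P[_ ? _ ?] ?; apply: subposet_ex. Qed.

(** Since covers are unit steps, the list has at most two values. At a minimal element both sides
    are the default value 0. *)
Lemma maxs_covers y p :
  maxs [seq y q | q <- enum [pred q | covers q p]] =
  max_below D (entry y) (val p).1 (val p).2.
Proof.
have inE a : a \in [seq y q | q <- enum [pred q | covers q p]] <->
    exists2 q, covers q p & a = y q.
  by split=> [/mapP[q]|[q cov ->]]; [rewrite mem_enum; exists q | rewrite map_f ?mem_enum].
have /and4P[i0 _ j0 _] := D_grid (subposet_in p).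
have left_q q : covers q p -> (val q).2 = (val p).2 :> nat ->
    D (val p).1.-1 (val p).2 /\ y q = entry y (val p).1.-1 (val p).2.
  rewrite subposet_coversE => cov e2; have e1 : (val q).1 = (val p).1.-1 :> nat by lia.
  by split; [rewrite -e1 -e2; apply: subposet_in | rewrite (entryE _ e1 e2)].
have low_q q : covers q p -> (val q).2 <> (val p).2 :> nat ->
    D (val p).1 (val p).2.-1 /\ y q = entry y (val p).1 (val p).2.-1.
  rewrite subposet_coversE => cov e2.
  have e1 : (val q).1 = (val p).1 :> nat by lia.
  have {}e2 : (val q).2 = (val p).2.-1 :> nat by lia.
  by split; [rewrite -e1 -e2; apply: subposet_in | rewrite (entryE _ e1 e2)].
have in_left : D (val p).1.-1 (val p).2 -> exists2 q, covers q p &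
    entry y (val p).1.-1 (val p).2 = y q.
  move=> /subposet_at[q [e1 e2]]; exists q; last exact: entryE.
  by rewrite subposet_coversE; lia.
have in_low : D (val p).1 (val p).2.-1 -> exists2 q, covers q p &
    entry y (val p).1 (val p).2.-1 = y q.
  move=> /subposet_at[q [e1 e2]]; exists q; last exact: entryE.
  by rewrite subposet_coversE; lia.
rewrite /max_below; case: ifP => D1; case: ifP => D2.
- apply: maxs_eq => [|a /inE[q cov ->]].
    by apply/inE; case: leP => _; [apply: in_low | apply: in_left].
  rewrite le_max; have [/(left_q _ cov)[_ ->]|/eqP/(low_q _ cov)[_ ->]] :=
    eqVneq ((val q).2 : nat) (val p).2; by rewrite lexx ?orbT.
- apply: maxs_eq => [|a /inE[q cov ->]]; first by apply/inE/in_left.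
  have [/(left_q _ cov)[_ -> //]|/eqP/(low_q _ cov)[]] :=
    eqVneq ((val q).2 : nat) (val p).2; by rewrite D2.
- apply: maxs_eq => [|a /inE[q cov ->]]; first by apply/inE/in_low.
  have [/(left_q _ cov)[]|/eqP/(low_q _ cov)[_ -> //]] :=
    eqVneq ((val q).2 : nat) (val p).2; by rewrite D1.
- rewrite (_ : enum _ = [::]) ?maxs_nil //; apply/eqP; rewrite -size_eq0 -cardE.
  apply/pred0P => q /=; apply/negP => cov.
  have [/(left_q _ cov)[]|/eqP/(low_q _ cov)[]] :=
    eqVneq ((val q).2 : nat) (val p).2; by rewrite ?D1 ?D2.
Qed.

Lemma mins_covers y p :
  mins [seq y q | q <- enum [pred q | covers p q]] =
  min_above D (entry y) (val p).1 (val p).2.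
Proof.
have inE a : a \in [seq y q | q <- enum [pred q | covers p q]] <->
    exists2 q, covers p q & a = y q.
  by split=> [/mapP[q]|[q cov ->]]; [rewrite mem_enum; exists q | rewrite map_f ?mem_enum].
have right_q q : covers p q -> (val q).2 = (val p).2 :> nat ->
    D (val p).1.+1 (val p).2 /\ y q = entry y (val p).1.+1 (val p).2.
  rewrite subposet_coversE => cov e2; have e1 : (val q).1 = (val p).1.+1 :> nat by lia.
  by split; [rewrite -e1 -e2; apply: subposet_in | rewrite (entryE _ e1 e2)].
have up_q q : covers p q -> (val q).2 <> (val p).2 :> nat ->
    D (val p).1 (val p).2.+1 /\ y q = entry y (val p).1 (val p).2.+1.
  rewrite subposet_coversE => cov e2.
  have e1 : (val q).1 = (val p).1 :> nat by lia.
  have {}e2 : (val q).2 = (val p).2.+1 :> nat by lia.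
  by split; [rewrite -e1 -e2; apply: subposet_in | rewrite (entryE _ e1 e2)].
have in_right : D (val p).1.+1 (val p).2 -> exists2 q, covers p q &
    entry y (val p).1.+1 (val p).2 = y q.
  move=> /subposet_at[q [e1 e2]]; exists q; last exact: entryE.
  by rewrite subposet_coversE; lia.
have in_up : D (val p).1 (val p).2.+1 -> exists2 q, covers p q &
    entry y (val p).1 (val p).2.+1 = y q.
  move=> /subposet_at[q [e1 e2]]; exists q; last exact: entryE.
  by rewrite subposet_coversE; lia.
rewrite /min_above; case: ifP => D1; case: ifP => D2.
- apply: mins_eq => [|a /inE[q cov ->]].
    by apply/inE; case: leP => _; [apply: in_right | apply: in_up].
  rewrite ge_min; have [/(right_q _ cov)[_ ->]|/eqP/(up_q _ cov)[_ ->]] :=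
    eqVneq ((val q).2 : nat) (val p).2; by rewrite lexx ?orbT.
- apply: mins_eq => [|a /inE[q cov ->]]; first by apply/inE/in_right.
  have [/(right_q _ cov)[_ -> //]|/eqP/(up_q _ cov)[]] :=
    eqVneq ((val q).2 : nat) (val p).2; by rewrite D2.
- apply: mins_eq => [|a /inE[q cov ->]]; first by apply/inE/in_up.
  have [/(right_q _ cov)[]|/eqP/(up_q _ cov)[_ -> //]] :=
    eqVneq ((val q).2 : nat) (val p).2; by rewrite D1.
- rewrite (_ : enum _ = [::]) /mins ?big_nil //; apply/eqP; rewrite -size_eq0 -cardE.
  apply/pred0P => q /=; apply/negP => cov.
  have [/(right_q _ cov)[]|/eqP/(up_q _ cov)[]] :=
    eqVneq ((val q).2 : nat) (val p).2; by rewrite ?D1 ?D2.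
Qed.

Lemma psi_entry x i j : D i j ->
  entry (psi x) i j = entry x i j + max_below D (entry (psi x)) i j.
Proof.
move=> /subposet_at[p [<- <-]].
by rewrite !entry_val {1}psi_rec maxs_covers.
Qed.

End Covers.

(** * Zeta preserves the height *)

Section ReachPsi.
Context {R : realFieldType}.
Implicit Types (D : rel nat) (x y : nat -> nat -> R).

Lemma reach_sub D D' x x' (S S' : nat -> nat -> R -> Prop) i j w :
  (forall i j, D i j -> D' i j) -> (forall i j, D i j -> x i j = x' i j) ->
  (forall i j w, D i j -> S i j w -> S' i j w) ->
  reach D x S i j w -> reach D' x' S' i j w.
Proof.
move=> sD eqx sS; elim=> {i j w} i j w Dij H; rewrite eqx // in H.
- by apply: reach_source; [apply: sD | apply: sS].
- by rewrite eqx // => H'; apply: reach_right; [apply: sD|].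
- by rewrite eqx // => H'; apply: reach_up; [apply: sD|].
Qed.

Definition src_minimal D i j (w : R) : Prop := [/\ w <= 0, ~~ D i.-1 j & ~~ D i j.-1].

(** Links the inductive paths to [psi], whose recursion is the hypothesis on [y]. At a minimal
    element the default value 0 of [max_below] matches the source condition w <= 0. *)
Lemma reach_minimalE D x y : (forall i j, D i j -> (0 < i)%N && (0 < j)%N) ->
  (forall i j, D i j -> y i j = x i j + max_below D y i j) ->
  forall i j w, D i j -> reach D x (src_minimal D) i j w <-> w <= y i j.
Proof.
move=> D0 yE i j w; have [n le_n] := ubnP (i + j).
elim: n i j w le_n => // n IHn i j w le_n Dij.
have /andP[i0 j0] := D0 _ _ Dij.
have IHl w' : D i.-1 j -> reach D x (src_minimal D) i.-1 j w' <-> w' <= y i.-1 j.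
  by apply: IHn; lia.
have IHd w' : D i j.-1 -> reach D x (src_minimal D) i j.-1 w' <-> w' <= y i j.-1.
  by apply: IHn; lia.
have -> : (w <= y i j) = (w - x i j <= max_below D y i j) by rewrite (yE _ _ Dij); lra.
rewrite /max_below; split.
  case/reachE=> _ [[w0 /negPf -> /negPf -> //]|[_ H]|[_ H]]; have Dq := reach_in H.
    by rewrite Dq; move/(IHl _ Dq): H; case: ifP => // _; rewrite le_max => ->.
  by rewrite Dq; move/(IHd _ Dq): H; case: ifP => // _; rewrite le_max => ->; rewrite orbT.
move=> H; apply/reachE; split=> //; move: H.
case: ifP => Dl; case: ifP => Dd H.
- move: H; rewrite le_max => /orP[/IHl|/IHd] H; first by constructor 2; split=> //; apply: H.
  by constructor 3; split=> //; apply: H.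
- by constructor 2; split=> //; apply/IHl.
- by constructor 3; split=> //; apply/IHd.
- by constructor 1; split=> //; rewrite ?Dl ?Dd.
Qed.

End ReachPsi.

Section Regions.
Context {r s : nat}.
Hypotheses (s_gt0 : (0 < s)%N) (s_le_r : (s <= r)%N).

Lemma grid_I k : (0 < k <= s)%N -> grid_region r s (inI r s k).
Proof. by move=> ks i j; region. Qed.

Lemma grid_M k : (0 < k < s)%N -> grid_region r s (inM r s k).
Proof. by move=> ks i j; region. Qed.

Lemma grid_T : grid_region r s (inT r s).
Proof. by move=> i j; region. Qed.

Lemma grid_R : grid_region r s (inR r s).
Proof. by move=> i j; region. Qed.

Lemma unit_steps_M k : (0 < k < s)%N -> unit_steps (inM r s k).
Proof. by move=> ks i j i' j'; region. Qed.

Lemma unit_steps_T : unit_steps (inT r s).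
Proof. by move=> i j i' j'; region. Qed.

Lemma unit_steps_R : unit_steps (inR r s).
Proof. by move=> i j i' j'; region. Qed.

Lemma inI1 i j : inI r s 1 i j = inR r s i j.
Proof. by apply/idP/idP; region. Qed.

Lemma inIs i j : inI r s s i j = inT r s i j.
Proof. by apply/idP/idP; region. Qed.

End Regions.

Section ZetaStep.
Context {R : realType} {r s k : nat}.
Hypotheses (k_bd : (0 < k < s)%N) (s_le_r : (s <= r)%N).

Let k_le_s : (0 < k <= s)%N. Proof. lia. Qed.
Let s_gt0 : (0 < s)%N. Proof. lia. Qed.
Let gridM := grid_M s_gt0 s_le_r k_bd.
Let unitM := unit_steps_M s_gt0 s_le_r k_bd.
Local Notation M := (inM r s k).

Section Entries.
Variable x : poset_I r s k.+1 -> R.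
Let y := entry (psi (xbar x)).
Let z := entry (zeta_step x).

Lemma psi_xbar_min : y k 1 = 0.
Proof.
have M1 : M k 1 by region.
rewrite /y psi_entry // /max_below.
have [p [p1 p2]] := subposet_at gridM M1.
rewrite (entryE _ p1 p2) /xbar p1 p2 !eqxx /= !ifF ?addr0 //; region.
Qed.

Lemma psi_xbarE i j : M i j -> ~~ ((i == k) && (j == 1%N)) ->
  y i j = entry x i j + max_below M y i j.
Proof.
move=> Mij nmin; rewrite /y psi_entry //; congr (_ + _).
have [p [p1 p2]] := subposet_at gridM Mij.
by rewrite (entryE _ p1 p2) /xbar p1 p2 (negPf nmin) /restrict_to p1 p2.
Qed.

Lemma zeta_stepM i j : M i j -> inI r s k i j -> z i j = min_above M y i j - y i j.
Proof.
move=> Mij Iij; have [p [p1 p2]] := subposet_at (grid_I s_gt0 s_le_r k_le_s) Iij.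
rewrite /z (entryE _ p1 p2) /zeta_step; case: insubP => [p' _ e|]; last by rewrite /= p1 p2 Mij.
by rewrite mins_covers // e p1 p2 /y; congr (_ - _); rewrite (@entryE _ _ _ _ _ p') // e.
Qed.

Lemma zeta_step_upper i j : inI r s k i j -> ~~ M i j -> (k.+1 < j)%N ->
  z i j = entry x i.+1 j.
Proof.
move=> Iij nM kj; have [p [p1 p2]] := subposet_at (grid_I s_gt0 s_le_r k_le_s) Iij.
rewrite /z (entryE _ p1 p2) /zeta_step; case: insubP => [p' Mp|_]; last by rewrite p1 p2 kj.
by rewrite /= p1 p2 (negPf nM) in Mp.
Qed.

Lemma zeta_step_left i j : inI r s k i j -> ~~ M i j -> (j <= k.+1)%N ->
  z i j = entry x i j.+1.
Proof.
move=> Iij nM kj; have [p [p1 p2]] := subposet_at (grid_I s_gt0 s_le_r k_le_s) Iij.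
rewrite /z (entryE _ p1 p2) /zeta_step; case: insubP => [p' Mp|_].
  by rewrite /= p1 p2 (negPf nM) in Mp.
by rewrite p1 p2 ltnNge kj.
Qed.

Lemma reach_zeta_step w : reach_boundary r s k z (r + k - 1) s w <->
  reach_boundary r s k.+1 (entry x) (r + k) s w.
Proof.
apply: (@reach_boundary_step _ r s k _ _ _ (entry x) y z); try lia.
- exact: psi_xbarE.
- exact: zeta_stepM.
- exact: zeta_step_upper.
- exact: zeta_step_left.
Qed.

End Entries.
End ZetaStep.

Section Height.
Context {R : realType} {r s : nat}.
Hypotheses (s_gt0 : (0 < s)%N) (s_le_r : (s <= r)%N).

Lemma reach_zeta_comp n (x : poset_I r s n.+1 -> R) w : (n < s)%N ->
  reach_boundary r s 1 (entry (zeta_comp x)) r s w <->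
  reach_boundary r s n.+1 (entry x) (r + n) s w.
Proof.
elim: n x => [|n IHn] x ns; first by rewrite addn0.
rewrite IHn; last by lia.
rewrite addnS -addSn; have := @reach_zeta_step R r s n.+1 ns s_le_r x w.
by rewrite addnS subn1 addSn.
Qed.

Lemma entry_restrict {D D' : rel nat} (x : subposet r s D -> R) i j :
  grid_region r s D' -> D' i j ->
  entry (restrict_to x : subposet r s D' -> R) i j = entry x i j.
Proof.
by move=> gridD' /(subposet_at gridD')[p [p1 p2]]; rewrite (entryE _ p1 p2) /restrict_to p1 p2.
Qed.

Lemma psi_zeta_top (x : poset_T r s -> R) :
  entry (psi (zeta x)) r s = entry (psi x) (r + s - 1) s.
Proof.
have gR := grid_R s_gt0 s_le_r; have gT := grid_T s_gt0 s_le_r.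
have topR : inR r s r s by region.
have topT : inT r s (r + s - 1) s by region.
suff eqw w : w <= entry (psi (zeta x)) r s <-> w <= entry (psi x) (r + s - 1) s.
  by apply/le_anti/andP; split; [apply: (eqw _).1 | apply: (eqw _).2].
have posR i j : inR r s i j -> (0 < i)%N && (0 < j)%N by region.
have posT i j : inT r s i j -> (0 < i)%N && (0 < j)%N by region.
have unitR := unit_steps_R s_gt0 s_le_r; have unitT := unit_steps_T s_gt0 s_le_r.
rewrite -(reach_minimalE posR (psi_entry gR unitR (zeta x)) w topR).
rewrite -(reach_minimalE posT (psi_entry gT unitT x) w topT).
have eR i j : inI r s 1 i j ->
    entry (zeta_comp (n := s.-1) (restrict_to x)) i j = entry (zeta x) i j.
  by rewrite inI1 // => Rij; rewrite entry_restrict.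
have s1 : s.-1.+1 = s by lia.
have eT i j : inI r s s.-1.+1 i j ->
    entry (restrict_to x : poset_I r s s.-1.+1 -> R) i j = entry x i j.
  move=> Iij; rewrite entry_restrict //; apply: grid_I => //; lia.
(* For k = 1 no row satisfies 1 < j <= k, so the only source is (1, 1), the least element of the
   rectangle. *)
apply: (iff_trans (B := reach_boundary r s 1
  (entry (zeta_comp (n := s.-1) (restrict_to x))) r s w)).
  split; apply: reach_sub => [i j|i j|i j w'].
  - by rewrite inI1.
  - by move=> Rij; rewrite eR ?inI1.
  - by move=> Rij [w0 n1 n2]; left; split=> //; region.
  - by rewrite inI1.
  - exact: eR.
  - move=> Iij [[i1 j1 w0]|[]]; last by lia.
    by rewrite i1 j1; split=> //; region.
rewrite reach_zeta_comp; last by lia.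
have -> : (r + s.-1 = r + s - 1)%N by lia.
(* For k = s the greatest element is itself on the staircase, so every path to it is counted. *)
apply: (iff_trans (B := reach_any r s s.-1.+1 (entry (restrict_to x : poset_I r s s.-1.+1 -> R))
  (r + s - 1) s w)).
  split; first by apply: reach_boundary_any; lia.
  by apply: reach_any_stair; lia.
split; apply: reach_sub => [i j|i j|i j w'].
- by rewrite s1 inIs.
- exact: eT.
- by rewrite s1 => Iij [ij w0]; split=> //; region.
- by rewrite s1 inIs.
- by move=> Tij; rewrite eT // s1 inIs.
- by rewrite s1 => Tij [w0 n1 n2]; split=> //; region.
Qed.

End Height.

(** * Inverting zeta *)

Section NeighbourTheory.
Context {R : realType}.
Implicit Types (D : rel nat) (y : nat -> nat -> R).

Lemma eq_max_below D y y' i j :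
  (forall i' j', D i' j' -> (i' + j' < i + j)%N -> y i' j' = y' i' j') ->
  (0 < i)%N -> (0 < j)%N -> max_below D y i j = max_below D y' i j.
Proof.
move=> eqy i0 j0; rewrite /max_below; case: ifP => D1; case: ifP => D2 //;
  by rewrite ?eqy //; lia.
Qed.

Lemma eq_min_above D y y' i j :
  (forall i' j', D i' j' -> (i + j < i' + j')%N -> y i' j' = y' i' j') ->
  min_above D y i j = min_above D y' i j.
Proof.
move=> eqy; rewrite /min_above; case: ifP => D1; case: ifP => D2 //;
  by rewrite ?eqy //; lia.
Qed.

Lemma min_aboveB D y c i j : D i.+1 j || D i j.+1 ->
  min_above D (fun i j => y i j - c) i j = min_above D y i j - c.
Proof.
rewrite /min_above; case: ifP => D1; case: ifP => D2 // _.
by case: leP => ?; case: leP => ? //; lra.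
Qed.

Lemma min_above_int D y i j : (forall i j, y i j \is a Num.int) ->
  min_above D y i j \is a Num.int.
Proof.
by move=> inty; rewrite /min_above; do ?case: ifP => _; rewrite ?rpred0 //; case: leP.
Qed.

Lemma max_below_int D y i j : (forall i j, y i j \is a Num.int) ->
  max_below D y i j \is a Num.int.
Proof.
by move=> inty; rewrite /max_below; do ?case: ifP => _; rewrite ?rpred0 //; case: leP.
Qed.

Lemma min_above_ge D y i j c : D i.+1 j || D i j.+1 ->
  (D i.+1 j -> c <= y i.+1 j) -> (D i j.+1 -> c <= y i j.+1) -> c <= min_above D y i j.
Proof.
rewrite /min_above; case: ifP => D1; case: ifP => D2 // _ h1 h2; rewrite ?le_min ?h1 ?h2 //.
Qed.

Lemma max_below_le D y i j c : D i.-1 j || D i j.-1 ->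
  (D i.-1 j -> y i.-1 j <= c) -> (D i j.-1 -> y i j.-1 <= c) -> max_below D y i j <= c.
Proof.
rewrite /max_below; case: ifP => D1; case: ifP => D2 // _ h1 h2; rewrite ?ge_max ?h1 ?h2 //.
Qed.

Lemma min_above_le D y i j : (D i.+1 j -> min_above D y i j <= y i.+1 j) /\
  (D i j.+1 -> min_above D y i j <= y i j.+1).
Proof.
rewrite /min_above; split=> ->; last case: ifP => _.
- by case: ifP => // _; rewrite ge_min lexx.
- by rewrite ge_min lexx orbT.
- by [].
Qed.

End NeighbourTheory.

Section Inverse.
Context {R : realType} {r s k : nat}.
Hypotheses (k_bd : (0 < k < s)%N) (s_le_r : (s <= r)%N).

Let k_le_s : (0 < k <= s)%N. Proof. lia. Qed.
Let k1_le_s : (0 < k.+1 <= s)%N. Proof. lia. Qed.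
Let s_gt0 : (0 < s)%N. Proof. lia. Qed.
Let gridM := grid_M s_gt0 s_le_r k_bd.
Let gridI := grid_I s_gt0 s_le_r k_le_s.
Let gridI1 := grid_I s_gt0 s_le_r k1_le_s.
Local Notation M := (inM r s k).

(** The top (r + k, k + 1) is the only element of M_k outside I_k, and the bottom (k, 1) the only
    one outside I_(k+1). Hence [min_above] and [max_below] do not take their default values where z
    and x are computed from them. *)
Let aboveM i j : M i j -> inI r s k i j -> M i.+1 j || M i j.+1.
Proof. by region. Qed.

Let belowM i j : M i j -> inI r s k.+1 i j -> M i.-1 j || M i j.-1.
Proof. by region. Qed.

(** The argument [n] is fuel. The amount needed at (i, j) is its distance in unit steps from the top
    (r + k, k + 1) of M_k. *)
Fixpoint descent (n : nat) (z : nat -> nat -> R) i j : R :=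
  if n is n'.+1 then min_above M (descent n' z) i j - z i j else 0.

(* The labelling y of M_k with top label 0 such that z is the difference between
   y and the minimum of y over the upper covers. *)
Definition from_top (z : nat -> nat -> R) i j := descent (r + k + k.+1 - (i + j)) z i j.

Lemma from_topE z i j : M i j -> inI r s k i j ->
  from_top z i j = min_above M (from_top z) i j - z i j.
Proof.
move=> Mij Iij; rewrite {1}/from_top.
have -> : (r + k + k.+1 - (i + j) = (r + k + k.+1 - (i + j).+1).+1)%N by region.
by rewrite /= /min_above /from_top (addSn i j) (addnS i j).
Qed.

(** The recursion determines a labeling from its top value, and subtracting a constant from a
    solution gives a solution again. *)
Lemma from_top_unique z y c : (forall i j, M i j -> inI r s k i j ->
    y i j = min_above M y i j - z i j) -> y (r + k)%N k.+1 = c ->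
  forall i j, M i j -> y i j - c = from_top z i j.
Proof.
move=> yE yc i j; have [n le_n] := ubnP (r + k + k.+1 - (i + j)).
elim: n i j le_n => // n IHn i j le_n Mij.
have [Iij|nI] := boolP (inI r s k i j); last first.
  have [-> ->] : i = (r + k)%N /\ j = k.+1 by region.
  by rewrite yc subrr /from_top subnn.
rewrite from_topE // yE // addrAC -(min_aboveB y _ (aboveM Mij Iij)); congr (_ - _).
by apply: eq_min_above => i' j' Mij' lt; apply: IHn => //; region.
Qed.

Lemma from_top_int z : (forall i j, z i j \is a Num.int) ->
  forall i j, from_top z i j \is a Num.int.
Proof.
move=> intz i j; rewrite /from_top; move: (r + k + k.+1 - _)%N => n.
elim: n i j => [|n IHn] i j /=; first exact: rpred0.
by rewrite rpredB // min_above_int.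
Qed.

(** Normalized to vanish at (k, 1), where [xbar], and hence [psi] of it, is 0. *)
Definition labelM (z : nat -> nat -> R) i j := from_top z i j - from_top z k 1.

Lemma labelME z i j : M i j -> inI r s k i j ->
  labelM z i j = min_above M (labelM z) i j - z i j.
Proof.
by move=> Mij Iij; rewrite min_aboveB ?aboveM // /labelM from_topE // addrAC.
Qed.

Definition zeta_step_inv (z : poset_I r s k -> R) : poset_I r s k.+1 -> R := fun p =>
  let i : nat := (val p).1 in let j : nat := (val p).2 in
  if M i j then labelM (entry z) i j - max_below M (labelM (entry z)) i j
  else if (k.+1 < j)%N then entry z i.-1 j else entry z i j.-1.

Lemma entry_zeta_step_inv z i j : inI r s k.+1 i j ->
  entry (zeta_step_inv z) i j =
  if M i j then labelM (entry z) i j - max_below M (labelM (entry z)) i j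
  else if (k.+1 < j)%N then entry z i.-1 j else entry z i j.-1.
Proof.
by move=> /(subposet_at gridI1)[p [p1 p2]]; rewrite (entryE _ p1 p2) /zeta_step_inv p1 p2.
Qed.

Lemma eq_entry {D : rel nat} (x y : subposet r s D -> R) : grid_region r s D ->
  (forall i j, D i j -> entry x i j = entry y i j) -> x = y.
Proof.
move=> gridD eqxy; apply/funext => p; rewrite -[LHS]entry_val -[RHS]entry_val.
exact/eqxy/subposet_in.
Qed.

Lemma zeta_step_invK : cancel zeta_step_inv (@zeta_step R r s k).
Proof.
move=> z; apply: eq_entry gridI _ => i j Iij; set x := zeta_step_inv z.
(* By induction upwards from (k, 1): [x] is the difference of the label and its maximum below, so
   the recursion of [psi] rebuilds the label. *)
have eqy i' j' : M i' j' -> entry (psi (xbar x)) i' j' = labelM (entry z) i' j'.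
  have [n le_n] := ubnP (i' + j'); elim: n i' j' le_n => // n IHn i' j' le_n Mij'.
  have [/andP[/eqP -> /eqP ->]|nmin] := boolP ((i' == k) && (j' == 1%N)).
    by rewrite psi_xbar_min // /labelM subrr.
  rewrite psi_xbarE // entry_zeta_step_inv; last by region.
  rewrite Mij' (@eq_max_below _ _ _ (labelM (entry z))) ?subrK //; try by region.
  by move=> i1 j1 M1 lt1; apply: IHn => //; lia.
have [Mij|nM] := boolP (M i j).
  rewrite zeta_stepM // eqy // labelME // opprB addrCA addrA.
  by rewrite (@eq_min_above _ _ _ (labelM (entry z))) ?addrK // => i' j' /eqy.
have [kj|jk] := ltnP k.+1 j.
  rewrite zeta_step_upper // entry_zeta_step_inv; last by region.
  by rewrite ifF ?kj //; region.
rewrite zeta_step_left // entry_zeta_step_inv; last by region.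
by rewrite !ifF //; region.
Qed.

Lemma zeta_stepK : cancel (@zeta_step R r s k) zeta_step_inv.
Proof.
move=> x; apply: eq_entry gridI1 _ => i j Iij; set z := zeta_step x.
set y := entry (psi (xbar x)).
have yE i' j' : M i' j' -> inI r s k i' j' -> y i' j' = min_above M y i' j' - entry z i' j'.
  by move=> M' I'; rewrite zeta_stepM // opprB addrCA subrr addr0.
(* By uniqueness [y] and [from_top] differ by a constant, and both [labelM] and [y] vanish at (k,
   1). *)
have eqy i' j' : M i' j' -> labelM (entry z) i' j' = y i' j'.
  move=> M'; have M1 : M k 1 by region.
  have y0 : y k 1 = 0 by exact: psi_xbar_min.
  by rewrite /labelM -!(from_top_unique yE (erefl _)) // y0 sub0r opprK subrK.
rewrite entry_zeta_step_inv //; case: ifPn => [Mij|nM].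
  rewrite eqy // (@eq_max_below _ _ _ y) //; try by region.
    by rewrite /y psi_xbarE ?addrK //; region.
  by move=> i' j' /eqy.
case: ifPn => kj.
  have i0 : (0 < i)%N by region.
  by rewrite zeta_step_upper ?prednK //; region.
have j0 : (0 < j)%N by region.
by rewrite zeta_step_left ?prednK //; region.
Qed.

Lemma entry_nat {D : rel nat} (x : subposet r s D -> R) :
  (forall p, x p \is a Num.nat) -> forall i j, entry x i j \is a Num.nat.
Proof. by move=> natx i j; rewrite /entry; case: pickP. Qed.

Lemma entry_homo {D : rel nat} (y : subposet r s D -> R) : grid_region r s D ->
  {homo y : p q / (p <= q)%O >-> p <= q} ->
  forall i j i' j', D i j -> D i' j' -> (i <= i')%N -> (j <= j')%N ->
  entry y i j <= entry y i' j'.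
Proof.
move=> gridD homoy i j i' j' /(subposet_at gridD)[p [p1 p2]].
move=> /(subposet_at gridD)[q [q1 q2]] le1 le2.
by rewrite (entryE _ p1 p2) (entryE _ q1 q2) homoy // subposet_leE p1 p2 q1 q2 le1.
Qed.

(** On M_k the new entries are nonnegative because [psi] of a nonnegative labeling is increasing. *)
Lemma zeta_step_nat (x : poset_I r s k.+1 -> R) : (forall p, x p \is a Num.nat) ->
  forall p, zeta_step x p \is a Num.nat.
Proof.
move=> natx p; rewrite -entry_val; move: (subposet_in p).
set i := nat_of_ord _; set j := nat_of_ord _ => Iij.
have natxb q : xbar x q \is a Num.nat.
  by rewrite /xbar; case: ifP => _; rewrite ?rpred0 // entry_nat.
have naty := entry_nat (psi_nat natxb).
have [Mij|nM] := boolP (inM r s k i j); last first.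
  have [kj|jk] := ltnP k.+1 j.
    by rewrite zeta_step_upper // entry_nat.
  by rewrite zeta_step_left // entry_nat.
rewrite zeta_stepM // natrEint rpredB ?min_above_int //=; try by move=> *; rewrite intr_nat.
have homoy := entry_homo gridM (psi_homo (fun q => natr_ge0 (natxb q))).
rewrite subr_ge0; apply: min_above_ge (aboveM Mij Iij) _ _ => M1; apply: homoy => //;
  exact: leqnSn.
Qed.

(** Nonnegative entries of [z] make [labelM] increasing, so its differences with the maximum below
    are nonnegative. *)
Lemma zeta_step_inv_nat (z : poset_I r s k -> R) : (forall p, z p \is a Num.nat) ->
  forall p, zeta_step_inv z p \is a Num.nat.
Proof.
move=> natz p; have natez := entry_nat natz.
rewrite /zeta_step_inv; case: ifP => Mij; last by case: ifP.
have intl i j : labelM (entry z) i j \is a Num.int.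
  by rewrite rpredB // from_top_int // => i' j'; rewrite intr_nat.
rewrite natrEint rpredB ?max_below_int //= subr_ge0.
have Iij := subposet_in p.
move: Mij Iij; set i := nat_of_ord _; set j := nat_of_ord _ => Mij Iij.
have lab_le i' j' : M i' j' -> inI r s k i' j' ->
    labelM (entry z) i' j' <= min_above M (labelM (entry z)) i' j'.
  by move=> M' I'; rewrite [leLHS]labelME // gerBl natr_ge0.
apply: max_below_le => [|M1|M1]; first exact: belowM.
  apply: le_trans (lab_le _ _ M1 _) _; first by region.
  have [+ _] := min_above_le M (labelM (entry z)) i.-1 j.
  by rewrite prednK; [apply | region].
apply: le_trans (lab_le _ _ M1 _) _; first by region.
have [_ +] := min_above_le M (labelM (entry z)) i j.-1.
by rewrite prednK; [apply | region].
Qed.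

End Inverse.

(** * The inverse of [zeta] and the bijection of plane partitions *)

Section ZetaInverse.
Context {R : realType} {r s : nat}.
Hypotheses (s_gt0 : (0 < s)%N) (s_le_r : (s <= r)%N).

Fixpoint zeta_comp_inv (n : nat) : (poset_I r s 1 -> R) -> (poset_I r s n.+1 -> R) :=
  if n is n'.+1 then @zeta_step_inv R r s n'.+1 \o zeta_comp_inv (n := n') else id.

Lemma zeta_compK n : (n < s)%N -> cancel (@zeta_comp R r s n) (@zeta_comp_inv n).
Proof.
elim: n => // n IHn ns x /=; rewrite IHn; last by lia.
by rewrite zeta_stepK.
Qed.

Lemma zeta_comp_invK n : (n < s)%N -> cancel (@zeta_comp_inv n) (@zeta_comp R r s n).
Proof.
elim: n => // n IHn ns x /=; rewrite zeta_step_invK //.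
by rewrite IHn //; lia.
Qed.

Lemma zeta_comp_nat n (x : poset_I r s n.+1 -> R) : (n < s)%N ->
  (forall p, x p \is a Num.nat) -> forall p, zeta_comp x p \is a Num.nat.
Proof.
elim: n x => //= n IHn x ns natx; apply: IHn; first by lia.
exact: zeta_step_nat.
Qed.

Lemma zeta_comp_inv_nat n (z : poset_I r s 1 -> R) : (n < s)%N ->
  (forall p, z p \is a Num.nat) -> forall p, zeta_comp_inv (n := n) z p \is a Num.nat.
Proof.
elim: n => //= n IHn ns natz; apply: zeta_step_inv_nat => //.
by apply: IHn => //; lia.
Qed.

Lemma restrict_toK (D D' : rel nat) : D =2 D' -> grid_region r s D ->
  cancel (@restrict_to R r s D D') restrict_to.
Proof.
move=> eqD gridD x; apply: (eq_entry gridD) => i j Dij.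
have gridD' : grid_region r s D' by move=> i' j'; rewrite -eqD; apply: gridD.
by rewrite !entry_restrict // -eqD.
Qed.

Lemma restrict_to_nat (D D' : rel nat) (x : subposet r s D -> R) :
  (forall p, x p \is a Num.nat) ->
  forall p, (restrict_to x : subposet r s D' -> R) p \is a Num.nat.
Proof. by move=> natx p; apply: entry_nat. Qed.

Definition zeta_inv : (poset_R r s -> R) -> (poset_T r s -> R) :=
  restrict_to \o zeta_comp_inv (n := s.-1) \o restrict_to.

Let eqT : inT r s =2 inI r s s.-1.+1.
Proof. by move=> i j; rewrite prednK // inIs. Qed.

Let eqR : inI r s 1 =2 inR r s.
Proof. by move=> i j; rewrite inI1. Qed.

Let s1 : (s.-1 < s)%N. Proof. lia. Qed.

Let gridI1 : grid_region r s (inI r s 1).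
Proof. by apply: grid_I. Qed.

Let gridIs : grid_region r s (inI r s s.-1.+1).
Proof. by apply: grid_I => //; lia. Qed.

Lemma zetaK : cancel (@zeta R r s) zeta_inv.
Proof.
move=> x; rewrite /zeta_inv /zeta /= (restrict_toK eqR) //.
by rewrite zeta_compK // (restrict_toK eqT) //; apply: grid_T.
Qed.

Lemma zeta_invK : cancel zeta_inv (@zeta R r s).
Proof.
move=> x; rewrite /zeta_inv /zeta /= (restrict_toK (fun i j => esym (eqT i j))) //.
by rewrite zeta_comp_invK // (restrict_toK (fun i j => esym (eqR i j))) //; apply: grid_R.
Qed.

Lemma zeta_nat (x : poset_T r s -> R) : (forall p, x p \is a Num.nat) ->
  forall p, zeta x p \is a Num.nat.
Proof.
move=> natx; apply: restrict_to_nat; apply: zeta_comp_nat => //.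
exact: restrict_to_nat.
Qed.

Lemma zeta_inv_nat (z : poset_R r s -> R) : (forall p, z p \is a Num.nat) ->
  forall p, zeta_inv z p \is a Num.nat.
Proof.
move=> natz; apply: restrict_to_nat; apply: zeta_comp_inv_nat => //.
exact: restrict_to_nat.
Qed.

Lemma psi_zeta_bij l : set_bij (plane_partitions l) (plane_partitions l)
  (psi \o @zeta R r s \o psi_inv).
Proof.
have gR := grid_R s_gt0 s_le_r; have gT := grid_T s_gt0 s_le_r.
have topR : inR r s r s by region.
have topT : inT r s (r + s - 1) s by region.
have [tR [tR1 tR2]] := subposet_at gR topR.
have [tT [tT1 tT2]] := subposet_at gT topT.
have maxR p : (p <= tR)%O.
  rewrite subposet_leE tR1 tR2.
  by have := gR _ _ (subposet_in p); have := subposet_in p; region.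
have maxT p : (p <= tT)%O.
  rewrite subposet_leE tT1 tT2.
  by have := gT _ _ (subposet_in p); have := subposet_in p; region.
have height x : psi (zeta x) tR = psi x tT :> R.
  by rewrite -(entryE _ tR1 tR2) -(entryE _ tT1 tT2) psi_zeta_top.
split.
- move=> y /(plane_partitionsE _ _ maxT)[naty yt].
  apply/(plane_partitionsE _ _ maxR); rewrite /= psiK height psi_invK; split=> //.
  exact: zeta_nat.
- apply: in2W; apply: (can_inj (g := psi \o zeta_inv \o psi_inv)) => y.
  by rewrite /= psiK zetaK psi_invK.
- move=> z /(plane_partitionsE _ _ maxR)[natz zt].
  exists (psi (zeta_inv (psi_inv z))); last by rewrite /= psiK zeta_invK psi_invK.
  apply/(plane_partitionsE _ _ maxT); rewrite psiK; split; first exact: zeta_inv_nat.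
  by rewrite -height zeta_invK psi_invK.
Qed.

End ZetaInverse.

(** * Piecewise linearity and continuity *)

Section Polyhedra.
Context {R : realType} {P : finType}.
Implicit Types (K : set (P -> R)).

(** With arbitrary finite index types, systems of inequalities are combined by sum types and
    dependent pairs. *)
Lemma polyhedron_fin (J : finType) (a : J -> P -> R) (b : J -> R) :
  polyhedron [set x : P -> R | forall j, \sum_p a j p * x p <= b j].
Proof.
exists #|J|, (a \o enum_val), (b \o enum_val); apply/seteqP; split=> x /= H i //.
by rewrite -[i]enum_rankK.
Qed.

Lemma polyhedronI K K' : polyhedron K -> polyhedron K' -> polyhedron (K `&` K').
Proof.
move=> [m [a [b ->]]] [m' [a' [b' ->]]].
rewrite (_ : _ `&` _ = [set x : P -> R | forall j : 'I_m + 'I_m',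
    \sum_p (match j with inl i => a i | inr i => a' i end) p * x p <=
    match j with inl i => b i | inr i => b' i end]); first exact: polyhedron_fin.
apply/seteqP; split=> x /=; first by move=> [H H'] [].
by move=> H; split=> i; [apply: (H (inl i)) | apply: (H (inr i))].
Qed.

Lemma polyhedron_forall (Q : finType) (K : Q -> set (P -> R)) :
  (forall q, polyhedron (K q)) -> polyhedron [set x | forall q, K q x].
Proof.
move=> polK.
have /choice[c cE] q : exists c : {m & (('I_m -> P -> R) * ('I_m -> R))%type},
    K q = [set x | forall i, \sum_p (tagged c).1 i p * x p <= (tagged c).2 i].
  have [m [a [b ->]]] := polK q.
  by exists (Tagged (fun m => (('I_m -> P -> R) * ('I_m -> R))%type) (a, b)).
rewrite (_ : [set x | _] = [set x : P -> R | forall j : {q & 'I_(tag (c q))},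
    \sum_p (tagged (c (tag j))).1 (tagged j) p * x p <=
    (tagged (c (tag j))).2 (tagged j)]); first exact: polyhedron_fin.
apply/seteqP; split=> x /=.
  by move=> H [q i] /=; have := H q; rewrite cE; apply.
by move=> H q; rewrite cE => i; have := H (existT _ q i).
Qed.

Lemma polyhedron_le (a a' : P -> R) (b b' : R) :
  polyhedron [set x : P -> R | \sum_p a p * x p + b <= \sum_p a' p * x p + b'].
Proof.
rewrite (_ : [set x | _] = [set x : P -> R | forall j : unit,
    \sum_p (a p - a' p) * x p <= b' - b]); first exact: polyhedron_fin.
have E x : \sum_p (a p - a' p) * x p = \sum_p a p * x p - \sum_p a' p * x p.
  by rewrite -sumrB; apply: eq_bigr => p _; rewrite mulrBl.
by apply/seteqP; split=> x /=; [move=> H _ | move=> /(_ tt)]; rewrite E; lra.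
Qed.

Lemma polyhedronT : polyhedron [set: P -> R].
Proof.
rewrite (_ : setT = [set x : P -> R | forall j : void,
    \sum_p (of_void _ j : P -> R) p * x p <= of_void _ j]); first exact: polyhedron_fin.
by apply/seteqP; split=> x // _ [].
Qed.

End Polyhedra.

(** * Functions generated from coordinates by sums, opposites and maxima *)

Section PiecewiseLinearFunctions.
Context {R : realType}.

(** Continuity and the decomposition into affine pieces are both proved by induction on this class,
    so the maps in question need only be shown to belong to it. *)
Inductive pl_fun {P : finType} : ((P -> R) -> R) -> Prop :=
| pl_coord p : pl_fun (fun x => x p)
| pl_zero : pl_fun (fun=> 0)
| pl_add f g : pl_fun f -> pl_fun g -> pl_fun (fun x => f x + g x)
| pl_opp f : pl_fun f -> pl_fun (fun x => - f x)
| pl_max f g : pl_fun f -> pl_fun g -> pl_fun (fun x => Num.max (f x) (g x)).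

Lemma pl_comp {P Q : finType} (g : (Q -> R) -> R) (f : (P -> R) -> (Q -> R)) :
  pl_fun g -> (forall q, pl_fun (fun x => f x q)) -> pl_fun (fun x => g (f x)).
Proof.
move=> plg plf; elim: plg => /= [q||g1 g2 _ ? _ ?|g1 _ ?|g1 g2 _ ? _ ?].
- exact: plf.
- exact: pl_zero.
- exact: pl_add.
- exact: pl_opp.
- exact: pl_max.
Qed.

Context {P : finType}.
Implicit Types (f g : (P -> R) -> R).

Lemma pl_sub f g : pl_fun f -> pl_fun g -> pl_fun (fun x => f x - g x).
Proof. by move=> plf plg; apply: pl_add => //; apply: pl_opp. Qed.

Lemma pl_min f g : pl_fun f -> pl_fun g -> pl_fun (fun x => Num.min (f x) (g x)).
Proof.
move=> plf plg; rewrite (_ : (fun x => _) = fun x => - Num.max (- f x) (- g x)).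
  by apply: pl_opp; apply: pl_max; apply: pl_opp.
by apply/funext => x; rewrite oppr_max !opprK.
Qed.

Lemma pl_sum (T : Type) (s : seq T) (F : T -> (P -> R) -> R) :
  (forall t, pl_fun (F t)) -> pl_fun (fun x => \sum_(t <- s) F t x).
Proof.
move=> plF; elim: s => [|t s IHs].
  by under eq_fun do rewrite big_nil; apply: pl_zero.
by under eq_fun do rewrite big_cons; apply: pl_add.
Qed.

Lemma pl_maxs (T : Type) (s : seq T) (F : T -> (P -> R) -> R) :
  (forall t, pl_fun (F t)) -> pl_fun (fun x => maxs [seq F t x | t <- s]).
Proof.
move=> plF; under eq_fun do rewrite /maxs big_map.
have pl_big h : pl_fun h -> pl_fun (fun x => \big[Num.max/h x]_(t <- s) F t x).
  move=> plh; elim: s => [|t s' IHs]; first by under eq_fun do rewrite big_nil.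
  by under eq_fun do rewrite big_cons; apply: pl_max.
(* The initial value of the iterated maximum is the head of the list, which varies with x and must
   belong to the class too. *)
by apply: (pl_big (fun x => head 0 _)); case: s {pl_big} => [|t s'] /=; [apply: pl_zero|].
Qed.

Lemma pl_mins (T : Type) (s : seq T) (F : T -> (P -> R) -> R) :
  (forall t, pl_fun (F t)) -> pl_fun (fun x => mins [seq F t x | t <- s]).
Proof.
move=> plF; under eq_fun do rewrite /mins big_map.
have pl_big h : pl_fun h -> pl_fun (fun x => \big[Num.min/h x]_(t <- s) F t x).
  move=> plh; elim: s => [|t s' IHs]; first by under eq_fun do rewrite big_nil.
  by under eq_fun do rewrite big_cons; apply: pl_min.
by apply: (pl_big (fun x => head 0 _)); case: s {pl_big} => [|t s'] /=; [apply: pl_zero|].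
Qed.

Lemma pl_fun_continuous f : pl_fun f -> continuous (f : {ptws P -> R} -> R).
Proof.
elim=> {f} [p||f g _ cf _ cg|f _ cf|f g _ cf _ cg] x.
- exact: (@proj_continuous P (fun=> R) p x).
- exact: (@cst_continuous {ptws P -> R} R 0 x).
- exact: (@continuousD R R^o {ptws P -> R} f g x (cf x) (cg x)).
- exact: (@continuousN R R^o {ptws P -> R} f x (cf x)).
- exact: (@continuous_max R {ptws P -> R} f g x (cf x) (cg x)).
Qed.

Lemma pl_continuous {Q : finType} (f : (P -> R) -> (Q -> R)) :
  (forall q, pl_fun (fun x => f x q)) ->
  continuous (f : {ptws P -> R} -> {ptws Q -> R}).
Proof.
move=> plf x.
(* The topology of pointwise convergence is the supremum of the initial topologies of the coordinate
   maps, so convergence is tested on each coordinate. *)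
pose Tq q := Topological.class (initial_topology (fun g : Q -> R => g q)).
have Ff : Filter (f @ (x : {ptws P -> R})).
  exact: (@fmap_filter {ptws P -> R} (Q -> R) f _ (@nbhs_filter {ptws P -> R} x)).
apply: (proj2 (@cvg_sup (Q -> R) Q Tq (f @ (x : {ptws P -> R})) (f x) Ff)) => q.
exact: (@continuous_comp_initial (Q -> R) {ptws P -> R} R (fun y => y q) f
  (pl_fun_continuous (plf q)) x).
Qed.

Definition pl_scalar (J : finType) f (K : J -> set (P -> R)) (a : J -> P -> R) (b : J -> R) :=
  [/\ forall x, exists j, K j x, forall j, polyhedron (K j)
    & forall j x, K j x -> f x = \sum_p a j p * x p + b j].

Lemma pl_fun_scalar f : pl_fun f ->
  exists (J : finType) (K : J -> set (P -> R)) a b, pl_scalar f K a b.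
Proof.
elim=> {f} [p||f g _ [J [K [a [b [cov pol fE]]]]] _ [J' [K' [a' [b' [cov' pol' gE]]]]]
  |f _ [J [K [a [b [cov pol fE]]]]]
  |f g _ [J [K [a [b [cov pol fE]]]]] _ [J' [K' [a' [b' [cov' pol' gE]]]]]].
- exists unit, (fun=> setT), (fun _ q => (q == p)%:R), (fun=> 0); split=> [x|_|_ x _].
  + by exists tt.
  + exact: polyhedronT.
  + rewrite addr0 (bigD1 p) //= eqxx mul1r big1 ?addr0 // => q /negPf ->.
    by rewrite mul0r.
- exists unit, (fun=> setT), (fun _ _ => 0), (fun=> 0); split=> [x|_|_ x _].
  + by exists tt.
  + exact: polyhedronT.
  + by rewrite addr0 big1 // => p _; rewrite mul0r.
- exists (J * J')%type, (fun j => K j.1 `&` K' j.2), (fun j p => a j.1 p + a' j.2 p),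
    (fun j => b j.1 + b' j.2); split=> [x|j|j x [Kx K'x]].
  + by have [j Kx] := cov x; have [j' K'x] := cov' x; exists (j, j').
  + exact: polyhedronI.
  + rewrite (fE _ _ Kx) (gE _ _ K'x) addrACA -big_split /=; congr (_ + _).
    by apply: eq_bigr => p _; rewrite mulrDl.
- exists J, K, (fun j p => - a j p), (fun j => - b j); split=> // j x /fE ->.
  rewrite opprD -sumrN; congr (_ - _).
  by apply: eq_bigr => p _; rewrite mulNr.
(* Each intersection of two pieces is cut in two by comparing the affine formulas for f and g. The
   Boolean is true on the part where that of g is the larger. *)
- pose L c (j : J * J') := [set x : P -> R |
    if c : bool then \sum_p a j.1 p * x p + b j.1 <= \sum_p a' j.2 p * x p + b' j.2
    else \sum_p a' j.2 p * x p + b' j.2 <= \sum_p a j.1 p * x p + b j.1].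
  exists (J * J' * bool)%type, (fun j => (K j.1.1 `&` K' j.1.2) `&` L j.2 j.1),
    (fun j => if j.2 then a' j.1.2 else a j.1.1),
    (fun j => if j.2 then b' j.1.2 else b j.1.1); split=> [x|[j c]|[j c] x [[Kx K'x] Lx]].
  + have [j Kx] := cov x; have [j' K'x] := cov' x.
    have [le_ab|/ltW le_ba] := leP (\sum_p a j p * x p + b j) (\sum_p a' j' p * x p + b' j').
      by exists (j, j', true).
    by exists (j, j', false).
  + apply: polyhedronI; first exact: polyhedronI.
    by case: c; apply: polyhedron_le.
  + rewrite (fE _ _ Kx) (gE _ _ K'x); case: c {Kx K'x} Lx => /= Lx; first exact/max_idPr.
    exact/max_idPl.
Qed.

Lemma pl_piecewise_linear {Q : finType} (f : (P -> R) -> (Q -> R)) :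
  (forall q, pl_fun (fun x => f x q)) -> piecewise_linear f.
Proof.
move=> plf.
have /choice[J Hf] := fun q => pl_fun_scalar (plf q).
(* The types of the remaining data depend on q through [J q], so they are chosen one after the other
   as dependent functions. *)
have [K {}Hf] : exists K : forall q, J q -> set (P -> R), forall q, exists a b,
    pl_scalar (fun x => f x q) (K q) a b.
  by exists (fun q => sval (cid (Hf q))) => q; apply: svalP (cid (Hf q)).
have [a {}Hf] : exists a : forall q, J q -> P -> R, forall q, exists b,
    pl_scalar (fun x => f x q) (K q) (a q) b.
  by exists (fun q => sval (cid (Hf q))) => q; apply: svalP (cid (Hf q)).
have [b {}Hf] : exists b : forall q, J q -> R, forall q,
    pl_scalar (fun x => f x q) (K q) (a q) (b q).
  by exists (fun q => sval (cid (Hf q))) => q; apply: svalP (cid (Hf q)).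
(* The common refinement has one piece for each choice of a piece for every coordinate q. *)
pose I := {dffun forall q, J q}.
exists #|I|, (fun i => [set x | forall q, K q ((enum_val i : I) q) x]); split.
  apply/seteqP; split=> // x _.
  have covx q : exists j, K q j x by have [cov _ _] := Hf q.
  exists (enum_rank ([ffun q => sval (cid (covx q))] : I)) => // q.
  by rewrite enum_rankK ffunE; exact: (svalP (cid (covx q))).
move=> i; split.
  apply: (polyhedron_forall (K := fun q => K q ((enum_val i : I) q))) => q.
  by have [_ pol _] := Hf q.
exists (fun x q => \sum_p a q ((enum_val i : I) q) p * x p + b q ((enum_val i : I) q)).
  by exists (fun q => a q ((enum_val i : I) q)), (fun q => b q ((enum_val i : I) q)).
by move=> x Kx; apply/funext => q; have [_ _ fE] := Hf q; apply: fE; apply: Kx.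
Qed.

End PiecewiseLinearFunctions.

Section PsiZetaPL.
Context {R : realType}.

Lemma pl_psi {d : Order.disp_t} {P : finPOrderType d} (p : P) :
  pl_fun (fun x : P -> R => psi x p).
Proof. by apply: pl_maxs => c; apply: pl_sum => q; apply: pl_coord. Qed.

Lemma pl_psi_inv {d : Order.disp_t} {P : finPOrderType d} (p : P) :
  pl_fun (fun x : P -> R => psi_inv x p).
Proof.
rewrite /psi_inv; case: (minimal p); first exact: pl_coord.
by apply: pl_sub; [apply: pl_coord | apply: pl_maxs => q; apply: pl_coord].
Qed.

Context {r s : nat}.

Lemma pl_entry (D : rel nat) i j : pl_fun (fun x : subposet r s D -> R => entry x i j).
Proof. by rewrite /entry; case: pickP => [p _|_]; [apply: pl_coord | apply: pl_zero]. Qed.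

Lemma pl_zeta_step k p : pl_fun (fun x : poset_I r s k.+1 -> R => zeta_step x p).
Proof.
rewrite /zeta_step; case: insubP => [p' _ _|_]; last by case: (_ < _)%N; apply: pl_entry.
have pl_y q : pl_fun (fun x : poset_I r s k.+1 -> R => psi (xbar x) q).
  apply: (pl_comp (pl_psi q)) => {}q; rewrite /xbar; case: (_ && _); first exact: pl_zero.
  exact: pl_entry.
by apply: pl_sub => //; apply: pl_mins.
Qed.

Lemma pl_zeta_comp n p : pl_fun (fun x : poset_I r s n.+1 -> R => zeta_comp x p).
Proof.
elim: n p => [|n IHn] p /=; first exact: pl_coord.
by apply: (pl_comp (IHn p)) => q; apply: pl_zeta_step.
Qed.

Lemma pl_zeta p : pl_fun (fun x : poset_T r s -> R => zeta x p).
Proof.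
apply: (pl_comp (pl_entry (inI r s 1) _ _)) => q.
by apply: (pl_comp (@pl_zeta_comp s.-1 q)) => t; apply: pl_entry.
Qed.

Lemma pl_psi_zeta p : pl_fun (fun x : poset_T r s -> R => psi (zeta (psi_inv x)) p).
Proof.
apply: (pl_comp (pl_psi p)) => q; apply: (pl_comp (pl_zeta q)) => {}q.
exact: pl_psi_inv.
Qed.

End PsiZetaPL.

Theorem corollary4p12 (R : realType) (r s : nat)
    (r_gt0 : (0 < r)%N) (s_gt0 : (0 < s)%N) (le_sr : (s <= r)%N) :
  let f : (poset_T r s -> R) -> (poset_R r s -> R) := psi \o zeta \o psi_inv in
  [/\ continuous (f : {ptws poset_T r s -> R} -> {ptws poset_R r s -> R}),
      piecewise_linear f
    & forall l : nat,
        set_bij (plane_partitions l) (plane_partitions l) f].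
Proof.
by split=> [||l]; [exact/pl_continuous/pl_psi_zeta
  | exact/pl_piecewise_linear/pl_psi_zeta | exact: psi_zeta_bij].
Qed.
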